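(* Let $s\in(0,1)$. For $j\in\{1,2\}$ let $(M_j,g_j)$ be closed, connected, $C^2$-regular Riemannian manifolds of dimension $n\ge2$. Let $(O_1,g_1)\subset(M_1,g_1)$ and $(O_2,g_2)\subset(M_2,g_2)$ be non-empty open sets such that $O_1=O_2=:O$. Let $\tilde L^1_{s,O},\tilde L^2_{s,O}$ be the solution-to-source operators (defined in the context) associated with the metrics $g_1,g_2$, and suppose that $\tilde L^1_{s,O}=\tilde L^2_{s,O}$. Then $g_1|_O=g_2|_O$.
   Context: For a closed Riemannian manifold $(M,g)$, $dV_g$ is the volume form, $-\Delta_g$ the Laplace--Beltrami operator with eigenvalues $0=\lambda_0<\lambda_1\le\dots$ and $L^2(M,dV_g)$-orthonormal eigenfunctions $(\phi_k)_{k\ge0}$, and $(-\Delta_g)^su:=\sum_{k\ge1}\lambda_k^s(u,\phi_k)_{L^2(M,dV_g)}\phi_k$ for $s\in(0,1)$. Solution-to-source operator: for $u\in C_c^\infty(O)$, $\tilde L_{s,O}(u):=f^u|_O\in H^{-s}(O)$, where $f^u=\sqrt{\det(g)}(-\Delta_g)^su$. Coordinate convention: $\det(g)$ is the determinant of the matrix of $g$ in fixed local coordinates on $O$, the same for both metrics; if $O$ is not covered by a single chart, $f^u|_O$ is understood as the coefficient function of the density $f^u\,dx$, so that the definition is independent of the choice of chart. $O_1=O_2$ means that the two sets are identified as manifolds, with the same coordinates. *)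

(* Defs.v *)
From HB Require Import structures.
From mathcomp Require Import all_boot all_order all_algebra.
From mathcomp Require Import all_classical all_reals all_analysis.

Set Implicit Arguments.
Unset Strict Implicit.
Unset Printing Implicit Defensive.

Import Order.TTheory GRing.Theory Num.Theory.
Import numFieldNormedType.Exports.

Local Open Scope classical_set_scope.
Local Open Scope ring_scope.

(** The library's instance of this fact is masked by a later one for products
    of finite measures. *)
Lemma product_sigma_finite (d1 d2 : measure_display) (T1 : measurableType d1)
    (T2 : measurableType d2) (R : realType)
    (m1 : {sigma_finite_measure set T1 -> \bar R})
    (m2 : {sigma_finite_measure set T2 -> \bar R}) :
  sigma_finite setT (m1 \x m2)%E.
Proof.
have /sigma_finiteP[F [TF ndF Foo]] := sigma_finiteT m1.
have /sigma_finiteP[G [TG ndG Goo]] := sigma_finiteT m2.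
exists (fun n => F n `*` G n).
  rewrite -setXTT TF TG predeqE => -[x y]; split.
    move=> [/= [n _ Fnx] [k _ Gky]]; exists (maxn n k) => //; split.
    - by move: x Fnx; exact/subsetPset/ndF/leq_maxl.
    - by move: y Gky; exact/subsetPset/ndG/leq_maxr.
  by move=> [n _ []/= ? ?]; split; exists n.
move=> k; have [? ?] := Foo k; have [? ?] := Goo k.
split; first exact: measurableX.
by rewrite product_measure1E// lte_mul_pinfty// ge0_fin_numE.
Qed.

(** [lebesgue_tuple n] is the n-fold product of the one-dimensional Lebesgue
    measure, on [n.-tuple R]; [lebesgue_row n] is the same measure on row
    vectors. *)
Section lebesgue_tuple.
Context {R : realType}.
Local Notation RT := (measurableTypeR R).

Section cons.
Variables (n : nat) (mu : {sigma_finite_measure set (n.-tuple RT) -> \bar R}).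

Let consf (p : RT * n.-tuple RT) : n.+1.-tuple RT :=
  [the n.+1.-tuple RT of p.1 :: p.2].

Let unconsf (t : n.+1.-tuple RT) : RT * n.-tuple RT :=
  (tnth t ord0, [tuple of behead t]).

Let consf_meas : measurable_fun setT consf.
Proof. exact: measurable_cons. Qed.

Let unconsf_meas : measurable_fun setT unconsf.
Proof.
by apply: measurable_fun_pair; [exact: measurable_tnth|exact: measurable_behead].
Qed.

Let unconsfK : cancel unconsf consf.
Proof.
by move=> t; apply: val_inj; rewrite /= [in RHS](tuple_eta t).
Qed.

Let consfK : cancel consf unconsf.
Proof.
by move=> [x t]; congr pair => //; apply: val_inj.
Qed.

Definition lebesgue_cons : set (n.+1.-tuple RT) -> \bar R :=
  pushforward (lebesgue_measure \x mu)%E consf.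

Let lebesgue_cons0 : lebesgue_cons set0 = 0%E.
Proof. by rewrite /lebesgue_cons /pushforward preimage_set0 measure0. Qed.

Let lebesgue_cons_ge0 A : (0 <= lebesgue_cons A)%E.
Proof. exact: measure_ge0. Qed.

Let lebesgue_cons_sigma_additive : semi_sigma_additive lebesgue_cons.
Proof.
move=> F mF tF mUF; rewrite /lebesgue_cons /pushforward preimage_bigcup.
apply: measure_semi_sigma_additive.
- by move=> k; rewrite -[X in measurable X]setTI; exact: consf_meas.
- apply/trivIsetP => /= i j _ _ ij; rewrite -preimage_setI.
  by move/trivIsetP : tF => /(_ _ _ _ _ ij) ->//; rewrite preimage_set0.
- by rewrite -preimage_bigcup -[X in measurable X]setTI; exact: consf_meas.
Qed.

HB.instance Definition _ := isMeasure.Build _ _ _ lebesgue_cons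
  lebesgue_cons0 lebesgue_cons_ge0 lebesgue_cons_sigma_additive.

Let lebesgue_cons_sigma_finite : sigma_finite setT lebesgue_cons.
Proof.
have [F FT Foo] := product_sigma_finite
  [the {sigma_finite_measure set _ -> \bar R} of lebesgue_measure] mu.
exists (fun k => unconsf @^-1` F k).
  by rewrite -preimage_bigcup -FT preimage_setT.
move=> k; have [mF Fk] := Foo k; split.
  by rewrite -[X in measurable X]setTI; exact: unconsf_meas.
rewrite /lebesgue_cons /pushforward -comp_preimage.
by rewrite (_ : unconsf \o consf = id) //; apply/funext.
Qed.

HB.instance Definition _ := Measure_isSigmaFinite.Build _ _ _ lebesgue_cons
  lebesgue_cons_sigma_finite.

End cons.

Fixpoint lebesgue_tuple (n : nat) :
    {sigma_finite_measure set (n.-tuple RT) -> \bar R} :=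
  match n with
  | 0 => [the {sigma_finite_measure set _ -> \bar R} of dirac [tuple]]
  | k.+1 =>
      [the {sigma_finite_measure set _ -> \bar R} of
         lebesgue_cons (lebesgue_tuple k)]
  end.

End lebesgue_tuple.

(** The product (hence Borel) sigma-algebra on row vectors. *)
Definition row_space (R : realType) (n : nat) : Type := 'rV[R]_n.

Section lebesgue_row.
Context {R : realType} (n : nat).
Local Notation RT := (measurableTypeR R).

HB.instance Definition _ := Pointed.on (row_space R n).

Let coord (i : 'I_n) (v : row_space R n) : RT := (v : 'rV[R]_n) ord0 i.

HB.instance Definition _ :=
  @isMeasurable.Build (sigma_display (g_sigma_preimage coord))
    (row_space R n) (g_sigma_preimage coord)
    (@sigma_algebra0 _ setT _) (@sigma_algebraC _ _)
    (@sigma_algebra_bigcup _ setT _).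

Definition row_of_tuple (t : n.-tuple RT) : row_space R n :=
  \row_(i < n) tnth t i.

Definition lebesgue_row : set (row_space R n) -> \bar R :=
  pushforward (lebesgue_tuple n) row_of_tuple.

Let row_of_tuple_meas : measurable_fun setT row_of_tuple.
Proof.
move=> _ Y mY; rewrite setTI.
have : preimage_set_system setT row_of_tuple (g_sigma_preimage coord)
    (row_of_tuple @^-1` Y) by exists Y => //; rewrite setTI.
rewrite -g_sigma_preimage_comp.
rewrite (_ : (fun i => _) = (fun i (t : n.-tuple RT) => tnth t i))//.
by apply/funext => i; apply/funext => t; rewrite /coord /row_of_tuple /= mxE.
Qed.

Let lebesgue_row0 : lebesgue_row set0 = 0%E.
Proof. by rewrite /lebesgue_row /pushforward preimage_set0 measure0. Qed.

Let lebesgue_row_ge0 A : (0 <= lebesgue_row A)%E.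
Proof. exact: measure_ge0. Qed.

Let lebesgue_row_sigma_additive : semi_sigma_additive lebesgue_row.
Proof.
move=> F mF tF mUF; rewrite /lebesgue_row /pushforward preimage_bigcup.
apply: measure_semi_sigma_additive.
- by move=> k; rewrite -[X in measurable X]setTI; exact: row_of_tuple_meas.
- apply/trivIsetP => /= i j _ _ ij; rewrite -preimage_setI.
  by move/trivIsetP : tF => /(_ _ _ _ _ ij) ->//; rewrite preimage_set0.
- by rewrite -preimage_bigcup -[X in measurable X]setTI; exact: row_of_tuple_meas.
Qed.

HB.instance Definition _ := isMeasure.Build _ _ _ lebesgue_row
  lebesgue_row0 lebesgue_row_ge0 lebesgue_row_sigma_additive.

End lebesgue_row.
Arguments lebesgue_row {R} n.

Fixpoint Ck (R : realType) (V W : normedModType R) (k : nat) (U : set V)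
    (f : V -> W) : Prop :=
  {in U, continuous f} /\
  match k with
  | 0 => True
  | m.+1 => forall v : V, (forall x, U x -> derivable f x v) /\ Ck m U ('D_v f)
  end.

Definition smooth_on (R : realType) (V W : normedModType R) (U : set V)
    (f : V -> W) : Prop := forall k, Ck k U f.

(** [cmap] is only meaningful on [cdom], and [cinv] on [cmap @` cdom]: charts
    that differ only by the values of these functions elsewhere stand for the
    same chart.  All notions below are insensitive to those values; in
    particular a maximal atlas contains either all or none of them. *)
Record chart (R : realType) (n : nat) (M : Type) := Chart {
  cdom : set M;
  cmap : M -> 'rV[R]_n;
  cinv : 'rV[R]_n -> M
}.

Definition cran (R : realType) (n : nat) (M : Type) (c : chart R n M) :
  set 'rV[R]_n := cmap c @` cdom c.

Section atlas.
Context {R : realType} {n : nat} {M : topologicalType}.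
Implicit Types (c d : chart R n M) (A : set (chart R n M)).

Definition is_chart c : Prop :=
  [/\ open (cdom c), open (cran c),
      (forall p, cdom c p -> cinv c (cmap c p) = p),
      {in cdom c, continuous (cmap c)} &
      {in cran c, continuous (cinv c)}].

Definition transition c d : 'rV[R]_n -> 'rV[R]_n := cmap d \o cinv c.

Definition overlap c d : set 'rV[R]_n := cmap c @` (cdom c `&` cdom d).

Definition compatible c d : Prop :=
  smooth_on (overlap c d) (transition c d) /\
  smooth_on (overlap d c) (transition d c).

Record smooth_structure A : Prop := SmoothStructure {
  atlas_chart : forall c, A c -> is_chart c;
  atlas_cover : forall p : M, exists2 c, A c & cdom c p;
  atlas_compatible : forall c d, A c -> A d -> compatible c d;
  atlas_maximal : forall c, is_chart c ->
    (forall d, A d -> compatible c d) -> A c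
}.

(** [g c x] is the matrix of the metric at the point of coordinates [x] of the
    chart [c].  Tangent vectors are row vectors, so that the Jacobian matrix of
    a transition map ('J) acts on their right. *)
Record C2_metric A (g : chart R n M -> 'rV[R]_n -> 'M[R]_n) : Prop := C2Metric {
  metric_C2 : forall c, A c ->
    forall i j, Ck 2 (cran c) (fun x => g c x i j : R^o);
  metric_sym : forall c, A c -> forall x, cran c x -> (g c x)^T = g c x;
  metric_pos : forall c, A c -> forall x, cran c x ->
    forall v : 'rV[R]_n, v != 0 -> 0 < (v *m g c x *m v^T) ord0 ord0;
  metric_change : forall c d, A c -> A d -> forall x, overlap c d x ->
    g c x = jacobian (transition c d) x *m g d (transition c d x)
              *m (jacobian (transition c d) x)^T
}.

End atlas.

(** Closed (compact, boundaryless) connected smooth manifolds of dimension [n]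
    with a Riemannian metric of class C^2. *)
Record closedRiemannian (R : realType) (n : nat) := ClosedRiemannian {
  carrier :> ptopologicalType;
  carrier_hausdorff : hausdorff_space carrier;
  carrier_compact : compact [set: carrier];
  carrier_connected : connected [set: carrier];
  atlas : set (chart R n carrier);
  atlasP : smooth_structure atlas;
  metric : chart R n carrier -> 'rV[R]_n -> 'M[R]_n;
  metricP : C2_metric atlas metric
}.
Arguments atlas {R n} _.
Arguments metric {R n _} c x.

Section riemannian.
Context {R : realType} {n : nat}.
Variable M : closedRiemannian R n.
Implicit Types (c : chart R n M) (u v w : M -> R) (O : set M).

Definition charts_in O : set (chart R n M) :=
  [set c | atlas M c /\ cdom c `<=` O].

Definition Ck_fun (k : nat) u : Prop :=
  forall c, atlas M c -> Ck k (cran c) (u \o cinv c : _ -> R^o).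

(** C_c^oo(O), its elements being extended by zero to the whole of [M]. *)
Definition test_function O u : Prop :=
  (forall k, Ck_fun k u) /\
  exists K : set M, [/\ compact K, K `<=` O & forall p, ~ K p -> u p = 0].

Definition sqrt_det c (x : 'rV[R]_n) : R := Num.sqrt (\det (metric c x)).

Definition borel : Type := g_sigma_algebraType (@open M).
HB.instance Definition _ := Measurable.on borel.

(** [mu] is the Riemannian volume dV_g = sqrt (det g) dx. *)
Definition is_volume (mu : {measure set borel -> \bar R}) : Prop :=
  forall c, atlas M c -> forall A : set borel, measurable A ->
    A `<=` cdom c ->
    mu A = (\int[lebesgue_row n]_(x in (cmap c @` A : set (row_space R n)))
              (sqrt_det c x)%:E)%E.

(** The coordinate expression
    (det g)^(-1/2) d_i ((det g)^(1/2) g^{ij} d_j u) of Delta_g u. *)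
Definition laplacian c u (x : 'rV[R]_n) : R :=
  let e (i : 'I_n) : 'rV[R]_n := delta_mx ord0 i in
  (sqrt_det c x)^-1 *
  \sum_(i < n) 'D_(e i) (fun y : 'rV[R]_n =>
    sqrt_det c y * \sum_(j < n) invmx (metric c y) i j
                                * 'D_(e j) (u \o cinv c : _ -> R^o) y : R^o) x.

(** Since the metric is of class C^2, elliptic regularity makes the
    eigenfunctions of class C^2, so that the eigenvalue equation is classical. *)
Definition eigenfunction (lam : R) (phi : M -> R) : Prop :=
  Ck_fun 2 phi /\
  forall c, atlas M c -> forall x, cran c x ->
    - laplacian c phi x = lam * phi (cinv c x).

Section spectral.
Variable mu : {measure set borel -> \bar R}.

Definition L2 w : Prop := (w : borel -> R) \in Lfun mu 2%:E.

Definition inner u v : R := \int[mu]_(x in setT) (u x * v x).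

Definition L2_limit (w_ : nat -> M -> R) w : Prop :=
  ('N[mu]_2%:E[ EFin \o (fun x : borel => (w x - w_ N x)%R) ])%E @[N --> \oo] --> 0%E.

Record spectral_resolution (lam : nat -> R) (phi : nat -> M -> R) : Prop :=
  SpectralResolution {
  eigenvalue0 : lam 0 = 0;
  eigenvalue_gt0 : lam 0 < lam 1;
  eigenvalue_le : forall k, lam k.+1 <= lam k.+2;
  eigenfunctionP : forall k, eigenfunction (lam k) (phi k);
  eigen_orthonormal : forall j k, inner (phi j) (phi k) = (j == k)%:R;
  eigen_complete : forall u, L2 u ->
    L2_limit (fun N x => \sum_(0 <= k < N) inner u (phi k) * phi k x) u
}.

Variables (lam : nat -> R) (phi : nat -> M -> R).

(** [w] represents (-Delta_g)^s u. *)
Definition is_frac_laplacian (s : R) u w : Prop :=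
  L2 w /\
  L2_limit (fun N x =>
    \sum_(1 <= k < N) (lam k `^ s) * inner u (phi k) * phi k x) w.

(** The solution-to-source operator, as a relation.  The density f^u dx on [O]
    is given by its coefficient function [f c] in each chart [c] of [O]; two
    such functions are identified when they are equal almost everywhere. *)
Definition solution_to_source (s : R) O u
    (f : chart R n M -> 'rV[R]_n -> R) : Prop :=
  exists2 w, is_frac_laplacian s u w &
  forall c, charts_in O c ->
    {ae lebesgue_row n, forall x : row_space R n, cran c x ->
       f c x = sqrt_det c x * w (cinv c x)}.

End spectral.
End riemannian.

Definition push_chart (R : realType) (n : nat) (M1 M2 : Type)
    (psi : M1 -> M2) (psi' : M2 -> M1) (c : chart R n M1) : chart R n M2 :=
  Chart (psi @` cdom c) (cmap c \o psi') (psi \o cinv c).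

(** [psi : O1 -> O2] is a diffeomorphism of inverse [psi'], that is, it
    exchanges the charts of [O1] and those of [O2].  A chart [c] of [O1] and the
    chart [push_chart psi psi' c] of [O2] are the same coordinates on
    O = O1 = O2. *)
Record identification (R : realType) (n : nat) (M1 M2 : closedRiemannian R n)
    (O1 : set M1) (O2 : set M2) (psi : M1 -> M2) (psi' : M2 -> M1) : Prop :=
  Identification {
  ident_fun : forall p, O1 p -> O2 (psi p) /\ psi' (psi p) = p;
  ident_inv : forall q, O2 q -> O1 (psi' q) /\ psi (psi' q) = q;
  ident_charts : forall c, charts_in O1 c -> charts_in O2 (push_chart psi psi' c);
  ident_charts_inv : forall c, charts_in O2 c ->
    charts_in O1 (push_chart psi' psi c)
}.

Definition push_fun (R : realType) (M1 M2 : Type) (O2 : set M2)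
    (psi' : M2 -> M1) (u : M1 -> R) : M2 -> R :=
  fun q => if q \in O2 then u (psi' q) else 0.

(* Main.v *)
Require Import Defs.
From HB Require Import structures.
From mathcomp Require Import all_boot all_order all_algebra.
From mathcomp Require Import all_classical all_reals all_analysis.
From mathcomp Require Import measurable_realfun polyrcf ring lra.

Set Implicit Arguments.
Unset Strict Implicit.
Unset Printing Implicit Defensive.

Import Order.TTheory GRing.Theory Num.Theory.
Import numFieldNormedType.Exports.

Local Open Scope classical_set_scope.
Local Open Scope ring_scope.

(** The metric is read off from the action of the fractional Laplacian on
    high-frequency wave packets.

    Fix coordinates of O, a point [x0] and a covector [xi <> 0].  Let [chi] be a
    bump function supported near [x0] and put
    u = chi(x) cos(t xi.x + a), with t large.  Applying -Delta_g to u multiplies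
    it by t^2 |xi|_g^2, up to terms of order t; if the support of [chi] is small,
    |xi|_g^2 is nearly equal to its value p at [x0].  Hence u is a quasimode: the
    norm of r = (-Delta_g - L) u is small compared with L ||u||, for L = t^2 p
    ([packet_energy]).  By Green's identity the k-th coefficient of r in the
    basis of eigenfunctions is (lambda_k - L) times that of u
    ([residual_inner]), and for 0 < s < 1 one has |x^s - 1| <= |x - 1| for
    x >= 0; so in the spectral expansion lambda_k^s may be replaced with L^s, at
    a cost controlled by r ([quasimode]):
    <(-Delta_g)^s u, u> = L^s ||u||^2 (1 + o(1)).
    Adding the contributions of the phases a = 0 and a = pi/2 turns ||u||^2 into
    the integral of sqrt(det g) chi^2, because cos^2 + sin^2 = 1.  Thus
    the sum of the two forms is equivalent to t^(2s) (|xi|_g^2)^s sqrt(det g),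
    taken at [x0], times the integral of chi^2 dx ([symbol_asymptotics]).

    Each of the two forms is the integral over O of u against the density
    sqrt(det g) (-Delta_g)^s u, that is, against the image of u by the
    solution-to-source operator ([source_pairing]).  Two metrics with the same
    operator therefore satisfy, at every point of O and for every xi,
    (|xi|_1^2)^s sqrt(det g_1) = (|xi|_2^2)^s sqrt(det g_2)  ([same_symbol]).
    So the dual quadratic forms are proportional, say g_2 = k g_1, and then
    det g_2 = k^n det g_1 turns the equality into k^(n/2) = k^s.  As
    n/2 >= 1 > s, k = 1 ([symbol_inj]). *)

(** * Functions of class C^k on an open set *)

Section Ck_calculus.
Context {R : realType}.
Implicit Types (V W : normedModType R).

Lemma near_open {T : topologicalType} (U : set T) (P : T -> Prop) x :
  open U -> (forall y, U y -> P y) -> U x -> \forall y \near x, P y.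
Proof. by move=> oU UP Ux; apply: filterS UP _; exact: open_nbhs_nbhs. Qed.

Lemma eq_on_continuous {V W : topologicalType} (U : set V) (f g : V -> W) x :
  open U -> {in U, f =1 g} -> U x -> {for x, continuous f} ->
  {for x, continuous g}.
Proof.
move=> oU fg Ux fx.
have fgx : {near x, f =1 g}.
  by apply: near_open Ux => // y Uy; apply: fg; rewrite inE.
rewrite /prop_for/continuous_at -fg ?inE//; apply: cvg_trans fx.
by apply: near_eq_cvg; exact: filterS fgx.
Qed.

Lemma eq_on_derive {V W} (U : set V) (f g : V -> W) x v :
  open U -> {in U, f =1 g} -> U x -> 'D_v f x = 'D_v g x.
Proof.
move=> oU fg Ux; apply: near_eq_derive.
by apply: near_open Ux => // y Uy; apply: fg; rewrite inE.
Qed.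

Lemma eq_on_derivable {V W} (U : set V) (f g : V -> W) x v :
  open U -> {in U, f =1 g} -> U x -> derivable f x v -> derivable g x v.
Proof.
move=> oU fg Ux; apply: near_eq_derivable.
by apply: near_open Ux => // y Uy; apply: fg; rewrite inE.
Qed.

Lemma Ck_eq {V W} k (U : set V) (f g : V -> W) :
  open U -> {in U, f =1 g} -> Ck k U f -> Ck k U g.
Proof.
move=> oU; elim: k f g => [|k IH] f g fg [cf df]; split => //.
- by move=> x /[!inE] Ux; apply: (eq_on_continuous oU fg Ux); apply: cf; rewrite inE.
- by move=> x /[!inE] Ux; apply: (eq_on_continuous oU fg Ux); apply: cf; rewrite inE.
- move=> v; have [dfv Df] := df v; split.
    by move=> x Ux; apply: (eq_on_derivable oU fg Ux (dfv x Ux)).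
  by apply: IH Df => x /[!inE] Ux; exact: (eq_on_derive v oU fg Ux).
Qed.

Lemma Ck_sub {V W} k (U U' : set V) (f : V -> W) :
  U' `<=` U -> Ck k U f -> Ck k U' f.
Proof.
move=> sU; elim: k f => [|k IH] f [cf df]; split => //.
- by move=> x /[!inE] Ux; apply: cf; rewrite inE; exact: sU.
- by move=> x /[!inE] Ux; apply: cf; rewrite inE; exact: sU.
- by move=> v; have [dfv /IH Df] := df v; split => // x /sU; exact: dfv.
Qed.

Lemma Ck_setU {V W} k (U U' : set V) (f : V -> W) :
  Ck k U f -> Ck k U' f -> Ck k (U `|` U') f.
Proof.
elim: k f => [|k IH] f [cf df] [cf' df']; split => //.
- by move=> x /[!inE] -[] Ux; [apply: cf|apply: cf']; rewrite inE.
- by move=> x /[!inE] -[] Ux; [apply: cf|apply: cf']; rewrite inE.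
- move=> v; have [dfv Df] := df v; have [dfv' Df'] := df' v.
  by split; [move=> x [/dfv|/dfv']|exact: IH].
Qed.

Lemma Ck_S {V W} k (U : set V) (f : V -> W) : Ck k.+1 U f -> Ck k U f.
Proof.
elim: k f => [|k IH] f [cf df]; split => //.
by move=> v; have [dfv /IH] := df v.
Qed.

Lemma Ck_continuous {V W} k (U : set V) (f : V -> W) :
  Ck k U f -> {in U, continuous f}.
Proof. by case: k => [|k] []. Qed.

Lemma Ck_cst {V W} k (U : set V) (a : W) : Ck k U (cst a).
Proof.
elim: k a => [|k IH] a; split => //.
- by move=> x _; exact: cvg_cst.
- by move=> x _; exact: cvg_cst.
- move=> v; split; first by move=> x _; exact: derivable_cst.
  rewrite (_ : 'D_v (cst a) = cst 0); first exact: IH.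
  by apply/funext => x; rewrite derive_cst.
Qed.

Lemma CkD {V W} k (U : set V) (f g : V -> W) : open U ->
  Ck k U f -> Ck k U g -> Ck k U (f \+ g).
Proof.
move=> oU; elim: k f g => [|k IH] f g [cf df] [cg dg]; split => //.
- by move=> x Ux; apply: cvgD; [exact: cf|exact: cg].
- by move=> x Ux; apply: cvgD; [exact: cf|exact: cg].
- move=> v; have [dfv Df] := df v; have [dgv Dg] := dg v; split.
    by move=> x Ux; apply: derivableD; [exact: dfv|exact: dgv].
  apply: Ck_eq (IH _ _ Df Dg) => // x /[!inE] Ux /=.
  by rewrite deriveD//; [exact: dfv|exact: dgv].
Qed.

Lemma CkM {V} k (U : set V) (f g : V -> R^o) : open U ->
  Ck k U f -> Ck k U g -> Ck k U (f \* g : V -> R^o).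
Proof.
move=> oU; elim: k f g => [|k IH] f g Cf Cg; have [cf df] := Cf; have [cg dg] := Cg; split => //.
- by move=> x Ux; apply: cvgM; [exact: cf|exact: cg].
- by move=> x Ux; apply: cvgM; [exact: cf|exact: cg].
- move=> v; have [dfv Df] := df v; have [dgv Dg] := dg v; split.
    by move=> x Ux; apply: derivableM; [exact: dfv|exact: dgv].
  have := CkD oU (IH _ _ (Ck_S Cf) Dg) (IH _ _ (Ck_S Cg) Df).
  apply: Ck_eq => // x /[!inE] Ux /=.
  by rewrite deriveM//; [exact: dfv|exact: dgv].
Qed.

Lemma Ck_sum {V W} k (U : set V) (I : Type) (r : seq I) (P : pred I) (F : I -> V -> W) :
  open U -> (forall i, P i -> Ck k U (F i)) ->
  Ck k U (fun x => \sum_(i <- r | P i) F i x).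
Proof.
move=> oU CF; elim: r => [|i r IH].
  by apply: Ck_eq (@Ck_cst V W k U 0) => // x _ /=; rewrite big_nil.
have [Pi|Pi] := boolP (P i); last first.
  by apply: Ck_eq IH => // x _ /=; rewrite big_cons (negbTE Pi).
by apply: Ck_eq (CkD oU (CF _ Pi) IH) => // x _ /=; rewrite big_cons Pi.
Qed.

Lemma Ck_prod {V} k (U : set V) (I : Type) (r : seq I) (P : pred I) (F : I -> V -> R^o) :
  open U -> (forall i, P i -> Ck k U (F i)) ->
  Ck k U (fun x => \prod_(i <- r | P i) F i x : R^o).
Proof.
move=> oU CF; elim: r => [|i r IH].
  by apply: Ck_eq (@Ck_cst V R^o k U 1) => // x _ /=; rewrite big_nil.
have [Pi|Pi] := boolP (P i); last first.
  by apply: Ck_eq IH => // x _ /=; rewrite big_cons (negbTE Pi).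
by apply: Ck_eq (CkM oU (CF _ Pi) IH) => // x _ /=; rewrite big_cons Pi.
Qed.

Lemma in_continuousM {V} (U : set V) (f g : V -> R^o) :
  {in U, continuous f} -> {in U, continuous g} ->
  {in U, continuous (fun x => f x * g x : R^o)}.
Proof. by move=> cf cg x Ux; apply: cvgM; [exact: cf|exact: cg]. Qed.

Lemma in_continuous_sqr {V} (U : set V) (f : V -> R^o) :
  {in U, continuous f} -> {in U, continuous (fun x => f x ^+ 2 : R^o)}.
Proof.
move=> cf x Ux; rewrite (_ : (fun x => f x ^+ 2 : R^o) = (fun x => f x * f x : R^o)).
  by apply: cvgM; exact: cf.
by apply/funext => y; rewrite expr2.
Qed.

Lemma in_continuousD {V} (U : set V) (f g : V -> R^o) :
  {in U, continuous f} -> {in U, continuous g} ->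
  {in U, continuous (fun x => f x + g x : R^o)}.
Proof. by move=> cf cg x Ux; apply: cvgD; [exact: cf|exact: cg]. Qed.

Lemma derive_mul {V} (f g : V -> R^o) x v : derivable f x v -> derivable g x v ->
  'D_v (fun y => f y * g y : R^o) x = f x * 'D_v g x + g x * 'D_v f x.
Proof. by move=> df dg; rewrite [LHS](deriveM df dg). Qed.

Lemma derive_sub {V} (f g : V -> R^o) x v : derivable f x v -> derivable g x v ->
  'D_v (fun y => f y - g y : R^o) x = 'D_v f x - 'D_v g x.
Proof. by move=> df dg; rewrite [LHS](deriveB df dg). Qed.

(** Restricting [f] to a line reduces this chain rule to the one-dimensional
    one, so that [f] need only be derivable in one direction. *)
Lemma derive_comp1 {V} (f : V -> R^o) (g : R^o -> R^o) x v :
  derivable f x v -> derivable g (f x) 1 ->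
  derivable (g \o f) x v /\ 'D_v (g \o f) x = 'D_1 g (f x) * 'D_v f x.
Proof.
move=> df dg.
pose h (t : R^o) : R^o := f (t *: v + x).
have hE : h 0 = f x by rewrite /h scale0r add0r.
have dh : derivable h 0 1 by exact: (derivable1P f x v).1 df.
have lineE (k : V -> R^o) : 'D_1 (fun t : R^o => k (t *: v + x)) 0 = 'D_v k x.
  rewrite /derive; set g1 := fun h => h^-1 *: _; set g2 := fun h => h^-1 *: _.
  suff -> : g1 = g2 by [].
  by apply/funext => t; rewrite /g1 /g2 /= addr0 scale0r add0r [_%:A]mulr1.
have dgh : derivable g (h 0) 1 by rewrite hE.
have dc : derivable (g \o h) 0 1.
  apply/derivable1_diffP; apply: differentiable_comp; first exact/derivable1_diffP.
  exact/derivable1_diffP.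
split; first exact: (derivable1P (g \o f) x v).2 dc.
rewrite -(lineE f) -(lineE (g \o f)) -[in RHS]hE.
by have := derive1_comp dh dgh; rewrite !derive1E.
Qed.

Lemma Ck_comp1 {V} k (U : set V) (I : set R^o) (f : V -> R^o) (g : R^o -> R^o) :
  open U -> open I -> (forall x, U x -> I (f x)) ->
  Ck k U f -> Ck k I g -> Ck k U (g \o f).
Proof.
move=> oU oI UI; elim: k g => [|k IH] g Cf Cg; have [cf df] := Cf; have [cg dg] := Cg; split => //.
- move=> x Ux; apply: continuous_comp; first exact: cf.
  by apply: cg; rewrite inE; apply: UI; rewrite inE in Ux.
- move=> x Ux; apply: continuous_comp; first exact: cf.
  by apply: cg; rewrite inE; apply: UI; rewrite inE in Ux.
- move=> v; have [dfv Df] := df v; have [dg1 Dg] := dg 1; split.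
    by move=> x Ux; apply: (derive_comp1 (dfv _ Ux) (dg1 _ _)).1; exact: UI.
  apply: Ck_eq (CkM oU (IH _ (Ck_S Cf) Dg) Df) => // x /[!inE] Ux /=.
  by rewrite (derive_comp1 (dfv _ Ux) (dg1 _ _)).2//; exact: UI.
Qed.

(** On the line, the derivative in the direction [v] is [v] times the derivative
    in the direction 1, so that one derivative is enough to gain one class. *)
Lemma Ck1_S k (I : set R) (g g' : R -> R) : open I ->
  (forall x, I x -> is_derive x 1 (g : R^o -> R^o) (g' x)) -> Ck k I (g' : R^o -> R^o) ->
  Ck k.+1 I (g : R^o -> R^o).
Proof.
move=> oI gg' Cg'; split.
  move=> x /[!inE] Ix; have [dg _] := gg' _ Ix.
  by apply: differentiable_continuous; apply/derivable1_diffP.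
move=> v; have H x : I x -> is_derive x v (g : R^o -> R^o) (v * g' x).
  move=> Ix; have [dg Dg] := gg' _ Ix.
  have dd : differentiable (g : R^o -> R^o) x by exact/derivable1_diffP.
  apply: DeriveDef; first exact: diff_derivable.
  by rewrite deriveE// deriv1E// derive1E Dg.
split; first by move=> x /H[].
apply: Ck_eq (CkM oI (Ck_cst k I (v : R^o)) Cg') => // x /[!inE] /H[_ ->] //.
Qed.

End Ck_calculus.

(** * Smooth functions of one variable *)

Section smooth_functions.
Context {R : realType}.
Implicit Types (V : normedModType R).

Lemma Ck_coord {V} n k (U : set V) (T : V -> 'rV[R]_n) i : open U ->
  Ck k U T -> Ck k U (fun x => T x ord0 i : R^o).
Proof.
move=> oU; elim: k T => [|k IH] T [cT dT]; split => //.
- by move=> x Ux; apply: (@continuous_comp _ _ _ T (fun M : 'rV[R]_n => M ord0 i : R^o)); [exact: cT|exact: coord_continuous].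
- by move=> x Ux; apply: (@continuous_comp _ _ _ T (fun M : 'rV[R]_n => M ord0 i : R^o)); [exact: cT|exact: coord_continuous].
- move=> v; have [dTv DT] := dT v; split.
    by move=> x Ux; exact: ((derivable_mxP _ _ _).1 (dTv x Ux)).
  apply: Ck_eq (IH _ DT) => // x /[!inE] Ux /=.
  by rewrite (derive_mx (dTv x Ux)) mxE.
Qed.

Lemma Ck_id {V} k : Ck k [set: V] (id : V -> V).
Proof.
case: k => [|k]; split => //; first by move=> x _; exact: cvg_id.
  by move=> x _; exact: cvg_id.
move=> v; split; first by move=> x _; exact: derivable_id.
rewrite (_ : 'D_v id = cst v); first exact: Ck_cst.
by apply/funext => x; rewrite derive_id.
Qed.

Lemma Ck_cos_sin k :
  Ck k [set: R] (@cos R : R^o -> R^o) /\ Ck k [set: R] (@sin R : R^o -> R^o).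
Proof.
have oT : open [set: R^o] by exact: openT.
elim: k => [|k [IHc IHs]].
  by split; split => // x _; [exact: continuous_cos|exact: continuous_sin].
split.
  apply: (@Ck1_S _ _ _ _ (fun x => -1 * sin x)) => //.
    by move=> x _; apply: is_derive_eq; rewrite mulN1r.
  by apply: CkM => //; exact: (Ck_cst _ _ (-1 : R^o)).
by apply: (@Ck1_S _ _ _ _ (@cos R)) => // x _.
Qed.

Lemma Ck_inv k : Ck k [set x : R^o | x != 0] (GRing.inv : R^o -> R^o).
Proof.
have oI : open [set x : R^o | x != 0] by exact: open_neq.
elim: k => [|k IH]; first by split => // x /[!inE] /= x0; exact: inv_continuous.
apply: (@Ck1_S _ _ _ _ (fun x => -1 * (x^-1 * x^-1))) => //.
  move=> x /= x0; have h := is_deriveV x0 (is_derive_id x 1).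
  by apply: (@is_derive_eq _ _ _ _ _ _ _ _ h); rewrite mulN1r expr2 invfM; exact: mulr1.
exact: CkM oI (Ck_cst k _ (-1 : R^o)) (CkM oI IH IH).
Qed.

Lemma Ck_sqrt k : Ck k [set x : R^o | 0 < x] (Num.sqrt : R^o -> R^o).
Proof.
have oI : open [set x : R^o | 0 < x] by exact: open_gt.
elim: k => [|k IH]; first by split => // x _; exact: sqrt_continuous.
apply: (@Ck1_S _ _ _ _ (fun x => (2 * Num.sqrt x)^-1)) => //.
apply: (Ck_comp1 (f := fun x : R^o => 2 * Num.sqrt x) (I := [set x : R^o | x != 0])) => //.
- by move=> x /= x0; rewrite mulf_neq0// gt_eqF ?sqrtr_gt0.
- exact: CkM oI (Ck_cst k _ (2 : R^o)) IH.
- exact: Ck_inv.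
Qed.

(** The derivatives of exp (-1/x), extended by 0, are combinations of products
    with powers of 1/x: the whole family is closed under differentiation. *)
Definition flat m (x : R) : R := if 0 < x then x^-1 ^+ m * expR (- x^-1) else 0.

(** The exponential dominates any power of 1/x; a quadratic bound is what makes
    [flat] derivable at the origin. *)
Lemma flat_le m x : `|flat m x| <= m.+2`!%:R * x ^+ 2.
Proof.
rewrite /flat; case: ifPn => [x0|_]; last by rewrite normr0 mulr_ge0// sqr_ge0.
have y0 : 0 < x^-1 by rewrite invr_gt0.
rewrite ger0_norm; last by rewrite mulr_ge0 ?expR_ge0// exprn_ge0// ltW.
rewrite expRN ler_pdivrMr ?expR_gt0//.
have := expR_ge1Dxn m.+1 (ltW y0); set E := expR _; set F : R := m.+2`!%:R => h.
have F0 : 0 < F by rewrite ltr0n fact_gt0.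
have : x^-1 ^+ m.+2 / F <= E by lra.
rewrite ler_pdivrMr// => h2.
have -> : x^-1 ^+ m = x ^+ 2 * x^-1 ^+ m.+2.
  have -> : x^-1 ^+ m.+2 = x^-1 ^+ m * x^-1 ^+ 2 by rewrite -exprD addn2.
  by rewrite mulrCA -exprMn mulfV ?expr1n ?mulr1// gt_eqF.
rewrite (_ : F * x ^+ 2 * E = x ^+ 2 * (E * F)); last by ring.
by rewrite ler_wpM2l ?sqr_ge0.
Qed.

Lemma is_derive_flat m (x : R) : is_derive (x : R^o) 1 (flat m : R^o -> R^o)
  (- m%:R * flat m.+1 x + flat m.+2 x).
Proof.
have [x0|x0|->] := ltgtP x 0.
- have h : {near x, cst 0 =1 flat m}.
    near=> y; rewrite /flat /= ltNge ltW//.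
    by near: y; exact: lt_nbhsl.
  apply: (near_eq_is_derive h).
  by apply: is_derive_eq; rewrite /flat ltNge ltW// mulr0 addr0.
- have h : {near x, (fun y : R => y^-1 ^+ m * expR (- y^-1)) =1 flat m}.
    near=> y; rewrite /flat /= ifT//.
    by near: y; exact: lt_nbhsr.
  apply: (near_eq_is_derive h).
  have xN0 : x != 0 by rewrite gt_eqF.
  rewrite /flat x0.
  have dV : is_derive (x : R^o) 1 (fun y : R^o => y^-1 : R^o) (- x ^- 2).
    have h1 := is_deriveV xN0 (is_derive_id x 1).
    by apply: (is_derive_eq h1); exact: mulr1.
  have dN : is_derive (x : R^o) 1 (fun y : R^o => - y^-1 : R^o) (x ^- 2).
    by have h1 := is_deriveN dV; apply: (is_derive_eq h1); rewrite opprK.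
  have dE : is_derive (x : R^o) 1 (fun y : R^o => expR (- y^-1) : R^o) (expR (- x^-1) * x ^- 2).
    exact: (@is_derive1_comp _ expR (fun y => - y^-1) _ _ _ (is_derive_expR _) dN).
  have dX := is_deriveX m dV.
  have dM := is_deriveM dX dE.
  rewrite (_ : (fun y : R => y^-1 ^+ m * expR (- y^-1)) =
      ((fun y : R^o => y^-1 : R^o) ^+ m * (fun y : R^o => expR (- y^-1) : R^o))); last first.
    by apply/funext => y; rewrite exprfctE.
  apply: (is_derive_eq dM); rewrite exprfctE -exprVn.
  change (x^-1 ^+ m * (expR (- x^-1) * x^-1 ^+ 2) +
    expR (- x^-1) * ((m%:R * x^-1 ^+ m.-1) * - x^-1 ^+ 2) =
    (- m%:R) * (x^-1 ^+ m.+1 * expR (- x^-1)) + x^-1 ^+ m.+2 * expR (- x^-1)).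
  by case: m {h dX dM} => [|m]; rewrite ?exprS /=; ring.
- have -> : - m%:R * flat m.+1 0 + flat m.+2 0 = 0 by rewrite /flat ltxx mulr0 addr0.
  have h : (fun h : R => h^-1 *: ((flat m \o shift 0) (h *: 1) - flat m 0)) @ 0^' --> (0 : R^o).
    apply/cvgrPdist_le => e e0; near=> h.
    have h0 : h != 0 by near: h; exact: nbhs_dnbhs_neq.
    rewrite /= addr0 [h%:A]mulr1 sub0r normrN {2}/flat ltxx subr0.
    rewrite normrM normfV mulrC ler_pdivrMr ?normr_gt0//.
    apply: (le_trans (flat_le _ _)).
    rewrite -real_normK ?num_real// expr2 mulrA ler_wpM2r//.
    rewrite -ler_pdivlMl ?ltr0n ?fact_gt0//.
    near: h; apply: dnbhs0_le.
    by rewrite mulr_gt0// invr_gt0 ltr0n fact_gt0.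
  by apply: DeriveDef; [apply/cvg_ex; exists 0|exact/cvg_lim].
Unshelve. all: by end_near. Qed.

Lemma Ck_flat k m : Ck k [set: R] (flat m : R^o -> R^o).
Proof.
have oT : open [set: R^o] by exact: openT.
elim: k m => [|k IH] m.
  split => // x _; have [dx _] := is_derive_flat m x.
  by apply: differentiable_continuous; exact/derivable1_diffP.
apply: (@Ck1_S _ _ _ _ (fun x => - m%:R * flat m.+1 x + flat m.+2 x)) => //.
  by move=> x _; exact: is_derive_flat.
exact: CkD oT (CkM oT (Ck_cst k _ (- m%:R : R^o)) (IH _)) (IH _).
Qed.

Lemma flat_gt0 m x : 0 < x -> 0 < flat m x.
Proof. by move=> x0; rewrite /flat x0 mulr_gt0 ?expR_gt0// exprn_gt0// invr_gt0. Qed.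

Lemma flat_ge0 m x : 0 <= flat m x.
Proof. by have [/flat_gt0/ltW//|x0] := ltP 0 x; rewrite /flat ltNge x0. Qed.

Lemma flat_le0 m x : x <= 0 -> flat m x = 0.
Proof. by move=> x0; rewrite /flat ltNge x0. Qed.

End smooth_functions.

(** * Lebesgue measure on row vectors *)

Section row_measure.
Context {R : realType}.
Local Notation RT := (measurableTypeR R).

Lemma row_norm_ltP n (v : 'rV[R]_n) r : 0 < r ->
  `|v| < r <-> forall i, `|v ord0 i| < r.
Proof.
move=> r0; rewrite [`|v|]/Num.Def.normr/= mx_normrE; split => [|h].
  move=> /bigmax_ltP[_ h] i; exact: (h (ord0, i) isT).
by apply/bigmax_ltP; split => // -[i j] _ /=; rewrite ord1.
Qed.

Lemma row_norm_leP n (v : 'rV[R]_n) r : 0 <= r ->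
  `|v| <= r <-> forall i, `|v ord0 i| <= r.
Proof.
move=> r0; rewrite [`|v|]/Num.Def.normr/= mx_normrE; split => [|h].
  move=> /bigmax_leP[_ h] i; exact: (h (ord0, i) isT).
by apply/bigmax_leP; split => // -[i j] _ /=; rewrite ord1.
Qed.

Lemma measurable_row_coord n (i : 'I_n) :
  measurable_fun setT (fun v : row_space R n => (v : 'rV[R]_n) ord0 i : RT).
Proof.
move=> _ A mA; rewrite setTI; apply: sub_sigma_algebra.
case: n i => [[]//|n] i; rewrite -bigcup_mkord_ord.
by exists i; [exact: ltn_ord|exists A => //; rewrite inord_val setTI].
Qed.

Lemma measurable_row d (T : measurableType d) n (f : T -> row_space R n) :
  (forall i, measurable_fun setT (fun x => (f x : 'rV[R]_n) ord0 i : RT)) ->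
  measurable_fun setT f.
Proof.
case: n f => [|n] f mf.
  apply: (@measurability _ _ _ _ _ _ set0); first by congr (<<s _ >>); rewrite big_ord0.
  by move=> _ [A []].
apply: (@measurability _ _ _ _ _ _ (\big[setU/set0]_(i < n.+1)
   preimage_set_system setT (fun v : row_space R n.+1 => (v : 'rV[R]_n.+1) ord0 i : RT) measurable)) => //.
move=> _ [A + <-]; rewrite -bigcup_mkord_ord => -[i _ [B mB <-]]; rewrite !setTI.
by rewrite -[X in measurable X]setTI; exact: (mf (inord i) measurableT B mB).
Qed.

Lemma measurable_box n (B : 'I_n -> set RT) : (forall i, measurable (B i)) ->
  measurable ([set v | forall i, B i ((v : 'rV[R]_n) ord0 i)] : set (row_space R n)).
Proof.
move=> mB; rewrite (_ : mkset _ = \bigcap_(i in setT)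
    ((fun v : row_space R n => (v : 'rV[R]_n) ord0 i : RT) @^-1` B i)); last first.
  by apply/seteqP; split => v /= h i; [move=> _|]; exact: h.
apply: fin_bigcap_measurable => // i _.
by rewrite -[X in measurable X]setTI; exact: measurable_row_coord.
Qed.

Lemma measurable_row_ball n (x : 'rV[R]_n) r :
  measurable ([set y | `|y - x| < r] : set (row_space R n)).
Proof.
have [r0|r0] := ltP 0 r; last first.
  rewrite (_ : mkset _ = set0); first exact: measurable0.
  by apply/seteqP; split => // y /=; rewrite ltNge (le_trans r0).
rewrite (_ : mkset _ = [set y | forall i, ball (x ord0 i : R^o) r ((y : 'rV[R]_n) ord0 i)]).
  by apply: (measurable_box (B := fun i => ball (x ord0 i) r : set RT)) => i; exact: measurable_ball.
apply/seteqP; split => y /=.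
  by move/(row_norm_ltP _ r0) => h i; have := h i; rewrite !mxE distrC.
by move=> h; apply/(row_norm_ltP _ r0) => i; have := h i; rewrite !mxE distrC.
Qed.

(** An open set is the union of the balls it contains whose centre is rational
    and whose radius is 1/(k+1), and there are countably many of them. *)
Lemma measurable_row_open n (A : set 'rV[R]_n) : open A ->
  measurable (A : set (row_space R n)).
Proof.
move=> oA.
pose F (p : 'rV[rat]_n * nat) : set 'rV[R]_n :=
  [set y | `|y - map_mx ratr p.1| < p.2.+1%:R^-1].
pose G (p : 'rV[rat]_n * nat) : set (row_space R n) :=
  if pselect (F p `<=` A) then F p else set0.
rewrite (_ : A = \bigcup_p G p); last first.
  apply/seteqP; split => [x Ax|x [p _]]; last first.
    by rewrite /G; case: pselect => // FA; exact: FA.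
  have /nbhs_ballP[e /= e0 eA] : nbhs x A by exact: open_nbhs_nbhs.
  have [k ke] : exists k : nat, k.+1%:R^-1 < e / 2.
    exists (Num.truncn (e / 2)^-1); rewrite -[ltRHS]invrK ltf_pV2 ?posrE ?invr_gt0 ?divr_gt0 ?ltr0n//.
    exact: truncnS_gt.
  have hq i : exists q : rat, `|x ord0 i - ratr q| < k.+1%:R^-1.
    have k0 : 0 < k.+1%:R^-1 :> R by rewrite invr_gt0.
    have /rat_in_itvoo[q] : x ord0 i - k.+1%:R^-1 < x ord0 i + k.+1%:R^-1.
      by rewrite ltrBlDr -addrA ltrDl addr_gt0.
    rewrite in_itv/= => /andP[h1 h2]; exists q.
    move: (k.+1%:R^-1) h1 h2 => c h1 h2; by rewrite ltr_norml; apply/andP; split; lra.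
  pose q : 'rV[rat]_n := \row_i (sval (cid (hq i))).
  have xq : F (q, k) x.
    apply/row_norm_ltP; first by rewrite invr_gt0.
    by move=> i; rewrite !mxE; case: cid.
  exists (q, k) => //; rewrite /G; case: pselect => // -[] y /= Fy; apply: eA.
  rewrite -ball_normE /=.
  have -> : x - y = (x - map_mx ratr q) - (y - map_mx ratr q) by rewrite opprB addrA subrK.
  rewrite (le_lt_trans (ler_normB _ _))// (splitr e) ltrD//; first exact: lt_trans ke.
  exact: lt_trans ke.
apply: countable_bigcupT_measurable; first exact: countableP.
by move=> p; rewrite /G; case: pselect => FA; [exact: measurable_row_ball|exact: measurable0].
Qed.

Lemma continuous_measurable_row n (A : set 'rV[R]_n) (f : 'rV[R]_n -> R) :
  open A -> {in A, continuous (f : _ -> R^o)} ->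
  measurable_fun (A : set (row_space R n)) (f : row_space R n -> RT).
Proof.
move=> oA cf; apply: (measurability _ (RGenOpens.measurableE R)).
move=> _ [B [a [b ->]] <-].
apply: measurable_row_open; rewrite openE => x [Ax fx].
have h : nbhs x (f @^-1` `]a, b[) by apply: cf; rewrite ?inE//; apply: open_nbhs_nbhs; split => //; exact: interval_open.
by apply: filterI => //; exact: open_nbhs_nbhs.
Qed.

(** The translation vector is a sequence, and not a tuple, for the sake of the
    induction on [n]. *)
Definition tuple_shift n (a : nat -> R) (t : n.-tuple RT) : n.-tuple RT :=
  [tuple (tnth t i + a i : RT) | i < n].

Lemma measurable_tuple_shift n a : measurable_fun setT (@tuple_shift n a).
Proof.
apply/measurable_fun_tnthP => i.
rewrite (_ : _ \o _ = (fun t : n.-tuple RT => tnth t i + a i)); last first.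
  by apply/funext => t; rewrite /= tnth_mktuple.
by apply: measurable_funD => //; exact: measurable_tnth.
Qed.

Lemma lebesgue_measure_shift (h : R) (A : set RT) : measurable A ->
  lebesgue_measure ((fun x : RT => x + h : RT) @^-1` A) = lebesgue_measure A.
Proof.
move=> mA.
have mh : measurable_fun setT (fun x : RT => x + h : RT) by exact: measurable_funD.
apply/esym.
apply: (lebesgue_measure_unique (mu := [the measure _ _ of pushforward lebesgue_measure (fun x : RT => x + h : RT)])) => //= _ [[a b]] _ <-.
rewrite /pushforward /=.
rewrite (_ : _ @^-1` _ = `]a - h, b - h]%classic); last first.
  by apply/seteqP; split => x /=; rewrite !in_itv/= => /andP[? ?]; apply/andP; split; lra.
rewrite !lebesgue_measure_itv/= !lte_fin ltrD2r.
by rewrite (_ : (b - h)%:E - (a - h)%:E = b%:E - a%:E)%E// -!EFinB; congr EFin; lra.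
Qed.

(** The translate of a product measure is characterised by its values on
    rectangles. *)
Lemma lebesgue_tuple_shift n a (A : set (n.-tuple RT)) : measurable A ->
  lebesgue_tuple n (tuple_shift a @^-1` A) = lebesgue_tuple n A.
Proof.
elim: n a A => [|n IH] a A mA.
  congr (lebesgue_tuple 0 _); apply/seteqP; split => t /=;
    by rewrite [tuple_shift _ _]tuple0 [t]tuple0.
pose consf (p : RT * n.-tuple RT) : n.+1.-tuple RT := [the n.+1.-tuple RT of p.1 :: p.2].
have mconsf : measurable_fun setT consf by exact: measurable_cons.
pose sh (p : RT * n.-tuple RT) : RT * n.-tuple RT := (p.1 + a 0%N, tuple_shift (a \o S) p.2).
have msh : measurable_fun setT sh.
  apply: measurable_fun_pair.
    by apply: measurable_funD => //; exact: measurable_fst.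
  by apply: measurableT_comp; [exact: measurable_tuple_shift|exact: measurable_snd].
have mcA : measurable (consf @^-1` A) by rewrite -[X in measurable X]setTI; exact: mconsf.
rewrite [LHS](_ : _ = (lebesgue_measure \x lebesgue_tuple n)%E (sh @^-1` (consf @^-1` A))); last first.
  rewrite /= /lebesgue_cons /pushforward; congr ((lebesgue_measure \x lebesgue_tuple n)%E _).
  apply/seteqP; split => -[x t] /=; congr (A _); apply: eq_from_tnth => i;
  rewrite tnth_mktuple; case: (unliftP ord0 i) => [j ->|->]; rewrite ?tnthS ?tnth_mktuple //=.
rewrite [RHS](_ : _ = (lebesgue_measure \x lebesgue_tuple n)%E (consf @^-1` A))//.
apply/esym.
apply: (product_measure_unique (m' := [the measure _ _ of pushforward (lebesgue_measure \x lebesgue_tuple n)%E sh])) => //= B C mB mC.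
rewrite /pushforward (_ : sh @^-1` _ = ((fun x : RT => x + a 0%N : RT) @^-1` B) `*` (tuple_shift (a \o S) @^-1` C)); last first.
  by apply/seteqP; split => -[x t].
rewrite product_measure1E; first by rewrite IH//; congr (_ * _)%E; exact: lebesgue_measure_shift.
- have mh : measurable_fun setT (fun x : RT => x + a 0%N : RT) by exact: measurable_funD.
  by rewrite -[X in measurable X]setTI; exact: mh.
- by rewrite -[X in measurable X]setTI; exact: measurable_tuple_shift.
Qed.

Lemma lebesgue_tuple_box n (B : nat -> set RT) : (forall i, measurable (B i)) ->
  lebesgue_tuple n [set t | forall i : 'I_n, B i (tnth t i)] =
  (\prod_(i < n) lebesgue_measure (B i))%E.
Proof.
elim: n B => [|n IH] B mB.
  rewrite big_ord0 /= diracE mem_set// => -[]//.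
pose consf (p : RT * n.-tuple RT) : n.+1.-tuple RT := [the n.+1.-tuple RT of p.1 :: p.2].
rewrite [LHS](_ : _ = (lebesgue_measure \x lebesgue_tuple n)%E
   (B 0%N `*` [set t | forall i : 'I_n, (B \o S) i (tnth t i)])); last first.
  rewrite /= /lebesgue_cons /pushforward; congr ((lebesgue_measure \x lebesgue_tuple n)%E _).
  apply/seteqP; split => -[x t] /=.
    move=> h; split; first exact: (h ord0).
    by move=> i; have := h (lift ord0 i); rewrite tnthS.
  by move=> [h1 h2] i; case: (unliftP ord0 i) => [j ->|->//]; rewrite tnthS; exact: h2.
have mB' : measurable [set t : n.-tuple RT | forall i : 'I_n, (B \o S) i (tnth t i)].
  rewrite (_ : mkset _ = \bigcap_(i in setT) ((fun t : n.-tuple RT => tnth t i) @^-1` (B i.+1))); last first.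
    by apply/seteqP; split => v /= h i; [move=> _|]; exact: h.
  apply: fin_bigcap_measurable => // i _.
  by rewrite -[X in measurable X]setTI; exact: measurable_tnth.
rewrite product_measure1E// big_ord_recl; congr (_ * _)%E.
rewrite (IH (B \o S)) => [|i]; last exact: mB.
by apply: eq_bigr.
Qed.

Lemma measurable_row_of_tuple n : measurable_fun setT (@row_of_tuple R n).
Proof.
apply: measurable_row => i.
rewrite (_ : (fun _ => _) = (fun t : n.-tuple RT => tnth t i)); first exact: measurable_tnth.
by apply/funext => t; rewrite mxE.
Qed.

Lemma lebesgue_row_box n (B : nat -> set RT) : (forall i, measurable (B i)) ->
  lebesgue_row n [set v | forall i : 'I_n, B i ((v : 'rV[R]_n) ord0 i)] =
  (\prod_(i < n) lebesgue_measure (B i))%E.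
Proof.
move=> mB; rewrite -lebesgue_tuple_box// /lebesgue_row /pushforward.
by congr (lebesgue_tuple n _); apply/seteqP; split => t /= h i; have := h i; rewrite mxE.
Qed.

Lemma lebesgue_row_shift n (w : 'rV[R]_n) (A : set (row_space R n)) : measurable A ->
  lebesgue_row n ((fun v : row_space R n => (v + w)%R : row_space R n) @^-1` A) = lebesgue_row n A.
Proof.
move=> mA; rewrite /lebesgue_row /pushforward.
pose a k : R := if insub k is Some i then w ord0 (i : 'I_n) else 0.
rewrite -[RHS](@lebesgue_tuple_shift n a); last first.
  by rewrite -[X in measurable X]setTI; exact: measurable_row_of_tuple.
congr (lebesgue_tuple n _); apply/seteqP; split => t /=; congr (A _);
  by apply/rowP => i; rewrite !mxE tnth_mktuple /a valK.
Qed.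

(** The norm of row vectors is the maximum norm, whose balls are cubes. *)
Lemma lebesgue_row_ball n (x : 'rV[R]_n) r : 0 < r ->
  lebesgue_row n [set y | `|y - x| < r] = ((r *+ 2) ^+ n)%:E.
Proof.
move=> r0.
pose a k : R := if insub k is Some i then x ord0 (i : 'I_n) else 0.
rewrite [X in lebesgue_row n X](_ : _ = [set v | forall i : 'I_n, (ball (a i : R^o) r : set RT) ((v : 'rV[R]_n) ord0 i)]).
  rewrite (@lebesgue_row_box n (fun i => ball (a i) r : set RT)); last by move=> i; exact: measurable_ball.
  under eq_bigr do rewrite lebesgue_measure_ball ?(ltW r0)//.
  by rewrite prodEFin prodr_const card_ord.
apply/seteqP; split => y /=.
  by move/(row_norm_ltP _ r0) => h i; have := h i; rewrite !mxE /a valK distrC.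
by move=> h; apply/(row_norm_ltP _ r0) => i; have := h i; rewrite !mxE /a valK distrC.
Qed.

End row_measure.

(** * Integrals of continuous functions of bounded support *)

Section row_integral.
Context {R : realType} {n : nat}.
Local Notation RT := (measurableTypeR R).
Local Notation leb := (@lebesgue_row R n).
Implicit Types (F : 'rV[R]_n -> R).

Definition vanishes_beyond (M : R) F := forall x, M < `|x| -> F x = 0.

Lemma open_beyond M : open [set x : 'rV[R]_n | M < `|x|].
Proof.
by apply: (open_comp (f := fun x : 'rV[R]_n => `|x|) (D := [set y | M < y]));
  [move=> x _; exact: norm_continuous|exact: open_gt].
Qed.

Definition row_cball M : set (row_space R n) := [set x : 'rV[R]_n | `|x| <= M].

Lemma row_cballE M : row_cball M = ~` [set x : 'rV[R]_n | M < `|x|].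
Proof.
by apply/seteqP; split => x /=; [rewrite /row_cball /= leNgt => /negP|move/negP; rewrite -leNgt].
Qed.

Lemma measurable_row_cball M : measurable (row_cball M).
Proof.
by rewrite row_cballE; apply: measurableC; apply: measurable_row_open; exact: open_beyond.
Qed.

Lemma compact_row_cball M : compact (row_cball M : set 'rV[R]_n).
Proof.
apply: bounded_closed_compact.
  by exists M; split; [exact: num_real|move=> r Mr x /= /le_trans; apply; exact: ltW].
by rewrite row_cballE; apply: open_closedC; exact: open_beyond.
Qed.

Lemma lebesgue_row_cball M : (leb (row_cball M) < +oo)%E.
Proof.
apply: (@le_lt_trans _ _ (leb [set x | `|x - 0| < `|M| + 1])).
  apply: le_measure; rewrite ?inE; [exact: measurable_row_cball|exact: measurable_row_ball|].
  by move=> x xM /=; rewrite subr0 (le_lt_trans xM)// ltr_pwDr// ler_norm.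
by rewrite lebesgue_row_ball ?ltry// ltr_wpDl.
Qed.

Lemma continuous_row_shift (w : 'rV[R]_n) : continuous (fun x : 'rV[R]_n => x + w : 'rV[R]_n).
Proof. by move=> x; exact: (cvgD (@cvg_id _ (nbhs x)) (cvg_cst w)). Qed.

Lemma continuous_measurable_rowT F : continuous (F : _ -> R^o) ->
  measurable_fun setT (F : row_space R n -> RT).
Proof.
move=> cF; apply: continuous_measurable_row; first exact: openT.
by move=> x _; exact: cF.
Qed.

Lemma vanishes_bounded M F : continuous (F : _ -> R^o) -> vanishes_beyond M F ->
  exists2 C, 0 <= C & forall x, `|F x| <= C.
Proof.
move=> cF vF.
have cB := @compact_row_cball M.
have /compact_bounded[r [_ hr]] : compact ((F : _ -> R^o) @` row_cball M).
  by apply: continuous_compact => //; apply: continuous_subspaceT.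
exists (`|r| + 1) => [|x]; first by rewrite addr_ge0.
have [xM|Mx] := leP `|x| M; last by rewrite vF// normr0 addr_ge0.
apply: (hr (`|r| + 1)); first by rewrite ltr_pwDr// ler_norm.
by exists x.
Qed.

Lemma integrable_row_indic C M :
  leb.-integrable setT (fun x => (C * \1_(row_cball M) x)%:E).
Proof.
have mB := measurable_row_cball M.
rewrite (_ : (fun _ => _) = (fun x => C%:E * (EFin \o \1_(row_cball M)) x)%E)//.
apply: integrableZl => //; apply/integrableP; split.
  by apply/measurable_EFinP; exact: measurable_indic.
rewrite (eq_integral (fun x => (\1_(row_cball M) x)%:E)); last first.
  by move=> t _; rewrite gee0_abs// lee_fin.
by rewrite integral_indic// setIT; exact: lebesgue_row_cball.
Qed.

Lemma integrable_row M F : continuous (F : _ -> R^o) -> vanishes_beyond M F ->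
  leb.-integrable setT (EFin \o F).
Proof.
move=> cF vF; have [C C0 FC] := vanishes_bounded cF vF.
apply: le_integrable (integrable_row_indic C M) => //.
  by apply/measurable_EFinP; exact: continuous_measurable_rowT.
move=> x _ /=; rewrite lee_fin indicE.
have [xM|Mx] := leP `|x : 'rV[R]_n| M.
  by rewrite mem_set// mulr1 [leRHS]ger0_norm.
by rewrite memNset ?mulr0 ?vF//; apply/negP; rewrite -ltNge.
Qed.

Lemma integral_row_shift M F (w : 'rV[R]_n) : continuous (F : _ -> R^o) ->
  vanishes_beyond M F ->
  (\int[leb]_x (F (x + w)%R)%:E = \int[leb]_x (F x)%:E)%E.
Proof.
move=> cF vF.
pose phi (x : row_space R n) : row_space R n := (x : 'rV[R]_n) + w.
have cphi := @continuous_row_shift w.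
have mphi : measurable_fun setT phi.
  apply: measurable_row => i.
  rewrite (_ : (fun _ => _) = (fun x : row_space R n => (x : 'rV[R]_n) ord0 i + w ord0 i)).
    by apply: measurable_funD => //; exact: measurable_row_coord.
  by apply/funext => x; rewrite mxE.
have cFphi : continuous ((fun x => F (x + w)) : _ -> R^o).
  by move=> x; apply: (@continuous_comp _ _ _ (fun x : 'rV[R]_n => x + w) (F : _ -> R^o)); [exact: cphi|exact: cF].
have vFphi : vanishes_beyond (M + `|w|) (fun x => F (x + w)).
  move=> x h; apply: vF; rewrite -(ltrD2r `|w|); apply: lt_le_trans h _.
  by rewrite -{1}(addrK w x) ler_normB.
have := @integral_pushforward _ _ _ _ R phi mphi leb setT (EFin \o F).
rewrite preimage_setT => <- //; last 2 first.
- by apply/measurable_EFinP; exact: continuous_measurable_rowT.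
- exact: integrable_row cFphi vFphi.
by apply: eq_measure_integral => A mA _; exact: lebesgue_row_shift.
Qed.

(** The translates of [F] have the same integral, hence so do its difference
    quotients, whose limit is the derivative. *)
Lemma integral_derive_eq0 M F (w : 'rV[R]_n) :
  continuous (F : _ -> R^o) -> (forall x, derivable (F : _ -> R^o) x w) ->
  continuous ('D_w (F : _ -> R^o)) -> vanishes_beyond M F ->
  (\int[leb]_x ('D_w (F : _ -> R^o) x)%:E = 0)%E.
Proof.
move=> cF dF cDF vF.
have vDF : vanishes_beyond M ('D_w (F : _ -> R^o)).
  move=> x Mx; rewrite -(derive_cst (0 : R^o) x w).
  apply: (@eq_on_derive _ _ _ [set y : 'rV[R]_n | M < `|y|]) => //.
    exact: open_beyond.
  by move=> y /[!inE] /= /vF.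
have [C C0 DFC] := vanishes_bounded cDF vDF.
pose h k : R := k.+1%:R^-1.
have h0 k : 0 < h k by rewrite invr_gt0.
have h1 k : h k <= 1 by rewrite invf_le1// ler1n.
pose Q k x : R := (h k)^-1 * (F (x + h k *: w) - F x).
have cS k : continuous ((fun x => F (x + h k *: w)) : _ -> R^o).
  move=> x; apply: (@continuous_comp _ _ _ (fun x : 'rV[R]_n => x + h k *: w) (F : _ -> R^o)); last exact: cF.
  exact: continuous_row_shift.
have cQ k : continuous (Q k : _ -> R^o).
  by move=> x; exact: (cvgM (cvg_cst (h k)^-1) (cvgB (cS k x) (cF x))).
(* By the mean value theorem, whence the dominated convergence below. *)
have QC k x : `|Q k x| <= C.
  pose f (t : R) : R := F (x + t *: w).
  have df t : is_derive (t : R^o) 1 (f : R^o -> R^o) ('D_w (F : _ -> R^o) (x + t *: w)).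
    have E : (fun h0 : R^o => h0^-1 *: (((f : R^o -> R^o) \o shift t) (h0 *: (1:R^o)) - f t)) =
             (fun h0 : R^o => h0^-1 *: (((F : _ -> R^o) \o shift (x + t *: w)) (h0 *: w) - F (x + t *: w))).
      apply/funext => a /=; rewrite /f [a%:A]mulr1 scalerDl.
      by congr (_ *: (F _ - _)); rewrite addrCA.
    apply: DeriveDef; first by rewrite /derivable E; exact: dF.
    by rewrite /derive E.
  have cf : {within `[0, h k], continuous f}.
    by apply: derivable_within_continuous => t _; have [] := df t.
  have [c _] := @MVT_segment R f (fun t => 'D_w (F : _ -> R^o) (x + t *: w)) 0 (h k) (ltW (h0 k))
    (fun t _ => df t) cf.
  rewrite /f scale0r addr0 subr0 /Q => ->.
  by rewrite mulrC mulfK ?gt_eqF.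
have vQ k : vanishes_beyond (M + `|w|) (Q k).
  move=> x Mx; rewrite /Q (vF x) ?(le_lt_trans _ Mx) ?lerDl// vF ?subrr ?mulr0//.
  rewrite -(ltrD2r `|w|); apply: lt_le_trans Mx _.
  rewrite -{1}(addrK (h k *: w) x) (le_trans (ler_normB _ _))// lerD2l.
  by rewrite normrZ ger0_norm ?(ltW (h0 k))// ler_piMl.
have IQ k : (\int[leb]_x (Q k x)%:E = 0)%E.
  rewrite /Q; under eq_integral do rewrite EFinM.
  rewrite integralZl//; last first.
    apply: (@integrable_row (M + `|w|) (fun x => F (x + h k *: w) - F x)).
      by move=> x; exact: (cvgB (cS k x) (cF x)).
    move=> x /(vQ k) /eqP; rewrite /Q mulf_eq0 invr_eq0 gt_eqF//= => /eqP ->//.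
  rewrite (_ : integral _ _ _ = 0%E) ?mule0//.
  have iF := integrable_row cF vF.
  under eq_integral do rewrite EFinB.
  rewrite integralB//; last first.
    apply: (@integrable_row (M + `|w|) (fun x => F (x + h k *: w)) (cS k)) => x Mx.
    have := vQ k x Mx; rewrite /Q (vF x) ?(le_lt_trans _ Mx) ?lerDl// subr0.
    by move/eqP; rewrite mulf_eq0 invr_eq0 gt_eqF//= => /eqP.
  rewrite (integral_row_shift _ cF vF) subee//.
  by apply: integrable_fin_num.
have /(cvg_lim (@ereal_hausdorff R)) <- : (\int[leb]_x (Q k x)%:E @[k --> \oo] --> \int[leb]_x ('D_w (F : _ -> R^o) x)%:E)%E.
  apply: (@dominated_cvg _ _ _ leb setT measurableT _ _
      (fun x => (C * \1_(row_cball (M + `|w|)) x)%:E)).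
  - by move=> k; apply/measurable_EFinP; exact: continuous_measurable_rowT.
  - move=> x _; apply: cvg_EFin; first by near=> k.
    have /cvgr_dnbhsP : (fun h : R^o => h^-1 *: (((F : _ -> R^o) \o shift x) (h *: w) - F x)) @ 0^' --> 'D_w (F : _ -> R^o) x.
      exact: dF.
    move=> /(_ h) H.
    have -> : fine \o (fun k => (Q k x)%:E) =
      (fun k => (h k)^-1 *: (((F : _ -> R^o) \o shift x) (h k *: w) - F x)).
      by apply/funext => k; rewrite /Q /= [h k *: w + _]addrC.
    apply: H; split; first by move=> k; rewrite gt_eqF.
    exact: cvg_harmonic.
  - by [].
  - exact: integrable_row_indic.
  - move=> k x _; rewrite lee_fin indicE.
    have [xM|Mx] := leP `|x : 'rV[R]_n| (M + `|w|).
      by rewrite mem_set// mulr1.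
    by rewrite memNset ?mulr0 ?vQ ?normr0//; apply/negP; rewrite -ltNge.
by rewrite (_ : (fun k => _) = cst 0%E); [exact: lim_cst|apply/funext].
Unshelve. all: by end_near. Qed.

End row_integral.

(** * Square-integrable functions *)

Section square_integrable.
Context d (T : measurableType d) (R : realType) (mu : {measure set T -> \bar R}).
Implicit Types (u v w : T -> R).
Local Notation L2 w := ((w : T -> R) \in Lfun mu 2%:E).
Local Notation inn u v := (\int[mu]_x (u x * v x)).

Lemma L2_measurable w : L2 w -> measurable_fun setT w.
Proof. by rewrite inE => /andP[]; rewrite inE. Qed.

Lemma L2P w : measurable_fun setT w ->
  (\int[mu]_x (w x ^+ 2)%:E < +oo)%E -> L2 w.
Proof.
move=> mw iw; rewrite inE; apply/andP; split; first by rewrite inE.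
rewrite !inE /= /finite_norm unlock /Lnorm poweR_lty//.
apply: le_lt_trans iw; rewrite le_eqVlt; apply/orP; left; apply/eqP.
by apply: eq_integral => x _ /=; rewrite powR_mulrn// -normrX ger0_norm// sqr_ge0.
Qed.

Lemma L2_integrable u v : L2 u -> L2 v -> mu.-integrable setT (EFin \o (u \* v)).
Proof. by move=> Lu Lv; apply/Lfun1_integrable; exact: Lfun2_mul_Lfun1. Qed.

Lemma L2Z a u : L2 u -> L2 (fun x => a * u x).
Proof.
have h1 : 1 <= 2 :> R by rewrite ler1n.
move=> /(Lfun_scale a h1) /=.
by under eq_fun do rewrite mulrC.
Qed.

Lemma L2D u v : L2 u -> L2 v -> L2 (fun x => u x + v x).
Proof.
move=> Lu Lv; apply: L2P.
  by apply: measurable_funD; exact: L2_measurable.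
have iuu := L2_integrable Lu Lu; have ivv := L2_integrable Lv Lv.
have : mu.-integrable setT (EFin \o (fun x => 2 * (u x * u x) + 2 * (v x * v x))).
  exact: (integrableD measurableT (integrableZl measurableT 2 iuu) (integrableZl measurableT 2 ivv)).
move/integrableP => [_]; apply: le_lt_trans; apply: ge0_le_integral => //.
- by move=> x _; rewrite lee_fin sqr_ge0.
- by apply/measurable_EFinP; apply: measurable_funX; apply: measurable_funD; exact: L2_measurable.
- apply: measurableT_comp => //; apply/measurable_EFinP.
  by apply: measurable_funD; apply: measurable_funM => //; apply: measurable_funM; exact: L2_measurable.
move=> x _; rewrite lee_fin ger0_norm.
  by have := sqr_ge0 (u x - v x); rewrite !expr2; lra.
by have := sqr_ge0 (u x); have := sqr_ge0 (v x); rewrite !expr2; lra.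
Qed.

Lemma inner_Zr a u v : L2 u -> L2 v -> inn u (fun x => a * v x) = a * inn u v.
Proof.
move=> Lu Lv; rewrite -RintegralZl//; last exact: L2_integrable.
by apply: eq_Rintegral => x _; rewrite mulrCA.
Qed.

Lemma inner_Dr u v w : L2 u -> L2 v -> L2 w ->
  inn u (fun x => v x + w x) = inn u v + inn u w.
Proof.
move=> Lu Lv Lw; rewrite -RintegralD//; try exact: L2_integrable.
by apply: eq_Rintegral => x _; rewrite mulrDr.
Qed.

Lemma L2_0 : L2 (fun=> 0).
Proof.
apply: L2P; first exact: measurable_cst.
by rewrite expr0n /= integral0.
Qed.

Lemma L2_sum (c : nat -> R) (f : nat -> T -> R) (r : seq nat) : (forall k, L2 (f k)) ->
  L2 (fun x => \sum_(k <- r) c k * f k x).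
Proof.
move=> Lf; elim: r => [|k r IH].
  by rewrite (_ : (fun _ => _) = fun=> 0); [exact: L2_0|apply/funext => x; rewrite big_nil].
rewrite (_ : (fun _ => _) = fun x => c k * f k x + \sum_(k <- r) c k * f k x); last first.
  by apply/funext => x; rewrite big_cons.
by apply: L2D => //; exact: L2Z.
Qed.

Lemma inner_sumr u (c : nat -> R) (f : nat -> T -> R) (r : seq nat) :
  L2 u -> (forall k, L2 (f k)) ->
  inn u (fun x => \sum_(k <- r) c k * f k x) = \sum_(k <- r) c k * inn u (f k).
Proof.
move=> Lu Lf; elim: r => [|k r IH].
  rewrite big_nil; under eq_Rintegral do rewrite big_nil mulr0.
  by rewrite Rintegral_cst// mul0r.
rewrite big_cons -IH -inner_Zr// -inner_Dr//; [|exact: L2Z|exact: L2_sum].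
by apply: eq_Rintegral => x _; rewrite big_cons.
Qed.

(** By the Cauchy-Schwarz inequality. *)
Lemma inner_cvg u w (w_ : nat -> T -> R) : L2 u -> L2 w -> (forall N, L2 (w_ N)) ->
  ('N[mu]_2%:E[EFin \o (fun x => (w x - w_ N x)%R)] @[N --> \oo] --> 0)%E ->
  inn u (w_ N) @[N --> \oo] --> inn u w.
Proof.
move=> Lu Lw Lw_ cw.
have LB N : L2 (fun x => w x - w_ N x).
  rewrite (_ : (fun _ => _) = fun x => w x + -1 * w_ N x).
    by apply: L2D => //; exact: L2Z.
  by apply/funext => x; rewrite mulN1r.
have bound N : (`|inn u w - inn u (w_ N)|%:E <=
    'N[mu]_2%:E[EFin \o u] * 'N[mu]_2%:E[EFin \o (fun x => w x - w_ N x)%R])%E.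
  rewrite -RintegralB//; try exact: L2_integrable.
  under eq_Rintegral do rewrite -mulrBr.
  rewrite EFin_normr_Rintegral//; last exact: (L2_integrable Lu (LB N)).
  apply: le_trans (hoelder _ (L2_measurable Lu) (L2_measurable (LB N)) _ _ _) => //; last first.
    by rewrite [RHS]splitr !div1r.
  rewrite Lnorm1; apply: le_abse_integral => //.
  by apply/measurable_EFinP; apply: measurable_funM; exact: L2_measurable.
have Nu : ('N[mu]_2%:E[EFin \o u] \is a fin_num)%E.
  by rewrite ge0_fin_numE ?Lnorm_ge0//; move: Lu; rewrite inE => /andP[_]; rewrite !inE.
have : (`|inn u w - inn u (w_ N)|%:E @[N --> \oo] --> 0)%E.
  apply: (@squeeze_cvge _ _ _ _ (cst 0%E) _ (fun N => 'N[mu]_2%:E[EFin \o u] * 'N[mu]_2%:E[EFin \o (fun x => w x - w_ N x)%R])%E).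
  - by apply: nearW => N; rewrite bound lee_fin normr_ge0.
  - exact: cvg_cst.
  - by rewrite -(mule0 ('N[mu]_2%:E[EFin \o u])%E); apply: cvgeZl.
move=> /fine_cvg /= h; apply/cvgrPdist_lt => e e0.
exact: (cvgr_lt 0 h e e0).
Qed.

End square_integrable.

(** * Spectral expansions and quasimodes *)

Section spectral_theory.
Context {R : realType} {n : nat} (M : closedRiemannian R n).
Local Notation RT := (measurableTypeR R).
Implicit Types (u v w : M -> R).

Lemma measurable_borel_open (A : set M) : open A -> measurable (A : set (borel M)).
Proof. by move=> oA; apply: sub_sigma_algebra. Qed.

Lemma continuous_measurable_borel (A : set M) (f : M -> R) :
  open A -> {in A, continuous (f : M -> R^o)} ->
  measurable_fun (A : set (borel M)) (f : borel M -> RT).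
Proof.
move=> oA cf; apply: (measurability _ (RGenOpens.measurableE R)).
move=> _ [B [a [b ->]] <-].
suff oI : open (A `&` f @^-1` `]a, b[) by exact: measurable_borel_open.
rewrite openE => x [Ax fx].
have h : nbhs x (f @^-1` `]a, b[) by apply: cf; rewrite ?inE//; apply: open_nbhs_nbhs; split => //; exact: interval_open.
by apply: filterI => //; exact: open_nbhs_nbhs.
Qed.

Lemma Ck_fun_continuous k u : Ck_fun k u -> continuous (u : M -> R^o).
Proof.
move=> Cu p; have [c Ac cp] := atlas_cover (atlasP M) p.
have [oc oran cK cmapc cinvc] := atlas_chart (atlasP M) Ac.
have ucont : {for cmap c p, continuous ((u \o cinv c) : _ -> R^o)}.
  by apply: (Ck_continuous (Cu _ Ac)); rewrite inE; exists p.
have H : {for p, continuous ((u \o cinv c) \o cmap c : M -> R^o)}.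
  by apply: continuous_comp => //; apply: cmapc; rewrite inE.
apply: (@eq_on_continuous _ _ (cdom c) ((u \o cinv c) \o cmap c)) => //.
by move=> q /[!inE] cq /=; rewrite cK.
Qed.

Lemma Ck_fun_measurable k u : Ck_fun k u -> measurable_fun setT (u : borel M -> RT).
Proof.
move=> Cu; apply: continuous_measurable_borel; first exact: openT.
by move=> x _; exact: Ck_fun_continuous Cu x.
Qed.

Variables (mu : {measure set (borel M) -> \bar R}) (lam : nat -> R) (phi : nat -> M -> R).
Hypothesis hspec : spectral_resolution mu lam phi.

(** The integral of [phi k ^+ 2], having a nonzero real part, is not infinite:
    the real part of an infinite value is 0 by convention. *)
Lemma eigenfunction_L2 k : L2 mu (phi k).
Proof.
have [Cphi _] := eigenfunctionP hspec k.
have mphi := Ck_fun_measurable Cphi.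
apply: L2P => //.
have := eigen_orthonormal hspec k k; rewrite eqxx /inner /Rintegral => h.
have : (0 <= \int[mu]_x (phi k x * phi k x)%:E)%E.
  by apply: integral_ge0 => x _; rewrite lee_fin -expr2 sqr_ge0.
under [X in _ -> (X < _)%E]eq_integral do rewrite expr2.
case: integral h => [r _ _||]; rewrite ?ltry//= => /esym/eqP; by rewrite oner_eq0.
Qed.

Lemma lam_ge0 k : 0 <= lam k.
Proof.
have h1 := eigenvalue_gt0 hspec; rewrite (eigenvalue0 hspec) in h1.
case: k => [|k]; first by rewrite (eigenvalue0 hspec).
by elim: k => [|k IH]; [exact: ltW|exact: le_trans IH (eigenvalue_le hspec k)].
Qed.

Lemma parseval u : L2 mu u ->
  \sum_(0 <= k < N) inner mu u (phi k) ^+ 2 @[N --> \oo] --> inner mu u u.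
Proof.
move=> Lu.
have := inner_cvg Lu Lu (fun N => L2_sum (fun k => inner mu u (phi k)) (index_iota 0 N) eigenfunction_L2)
  (eigen_complete hspec Lu).
apply: cvg_trans; apply: near_eq_cvg; near=> N.
rewrite inner_sumr//; last exact: eigenfunction_L2.
Unshelve. all: by end_near. Qed.

Lemma bessel u N : L2 mu u ->
  \sum_(0 <= k < N) inner mu u (phi k) ^+ 2 <= inner mu u u.
Proof.
move=> Lu; have cu := parseval Lu.
have nd : nondecreasing_seq (fun N => \sum_(0 <= k < N) inner mu u (phi k) ^+ 2).
  by apply/nondecreasing_seqP => m; rewrite big_nat_recr//= lerDl sqr_ge0.
rewrite -(cvg_lim (@Rhausdorff R) cu).
by apply: nondecreasing_cvgn_le => //; apply/cvg_ex; exists (inner mu u u).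
Qed.

(** The sum, which defines the fractional Laplacian from index 1 on, may start
    at 0 because lambda_0 = 0 and a nonzero power of 0 vanishes. *)
Lemma frac_laplacian_inner s u w : s != 0 -> L2 mu u -> is_frac_laplacian mu lam phi s u w ->
  \sum_(0 <= k < N) lam k `^ s * inner mu u (phi k) ^+ 2 @[N --> \oo] --> inner mu u w.
Proof.
move=> s0 Lu [Lw cw].
have := inner_cvg Lu Lw (fun N => L2_sum (fun k => lam k `^ s * inner mu u (phi k)) (index_iota 1 N) eigenfunction_L2) cw.
apply: cvg_trans; apply: near_eq_cvg; near=> N.
rewrite inner_sumr//; last exact: eigenfunction_L2.
have N0 : (0 < N)%N by near: N; exact: nbhs_infty_gt.
rewrite [RHS]big_ltn// (eigenvalue0 hspec) powR0// mul0r add0r.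
by apply: eq_bigr => k _; rewrite expr2 mulrA.
Unshelve. all: by end_near. Qed.

End spectral_theory.

Section quasimode.
Context {R : realType}.

(** The power [x `^ s] lies between 1 and [x]. *)
Lemma powR_sub1 (x s : R) : 0 <= x -> 0 < s < 1 -> `|x `^ s - 1| <= `|x - 1|.
Proof.
move=> x0 /andP[s0 s1]; have one_s : 1 `^ s = 1 by rewrite powR1.
have [x1|/ltW x1] := leP 1 x.
  have h : 1 <= x `^ s by rewrite -[X in X <= _]one_s ge0_ler_powR// ?nnegrE// ltW.
  rewrite !ger0_norm ?subr_ge0// lerB//.
  by apply: ler1_powR => //; exact: ltW.
have [->|xN0] := eqVneq x 0; first by rewrite powR0// gt_eqF.
have xp : 0 < x by rewrite lt0r xN0.
have h : x `^ s <= 1 by rewrite -[X in _ <= X]one_s ge0_ler_powR// ?nnegrE// ltW.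
have h2 : x <= x `^ s by apply: ger1_powR; rewrite ?xp// ltW.
by rewrite !ler0_norm ?subr_le0//; lra.
Qed.

(** The linear estimate |y^s - 1| <= |y - 1|, for y = x / L, is weakened to a
    quadratic one by z <= z^2 / (2 eta) + eta / 2: summed against squares of
    Fourier coefficients, it will only involve squared norms. *)
Lemma powR_close (L s eta x : R) : 0 < L -> 0 < s < 1 -> 0 < eta -> 0 <= x ->
  `|x `^ s - L `^ s| <= L `^ s * ((x - L) ^+ 2 / (2 * eta * L ^+ 2) + eta / 2).
Proof.
move=> L0 s01 eta0 x0.
have LN0 : L != 0 by rewrite gt_eqF.
have -> : x = L * (x / L) by rewrite mulrCA mulfV// mulr1.
set y := x / L; have y0 : 0 <= y by rewrite divr_ge0// ltW.
rewrite powRM ?(ltW L0)// -{2}[L `^ s]mulr1 -mulrBr normrM ger0_norm ?powR_ge0//.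
rewrite ler_wpM2l ?powR_ge0//.
apply: (le_trans (powR_sub1 y0 s01)).
have -> : (L * y - L) ^+ 2 / (2 * eta * L ^+ 2) = `|y - 1| ^+ 2 / (2 * eta).
  by rewrite real_normK ?num_real//; field; rewrite LN0 gt_eqF.
set z := `|y - 1|.
have -> : z ^+ 2 / (2 * eta) + eta / 2 = z + (z - eta) ^+ 2 / (2 * eta).
  by field; rewrite gt_eqF.
by rewrite lerDl divr_ge0 ?sqr_ge0// mulr_ge0// ltW.
Qed.

Context {n : nat} (M : closedRiemannian R n).
Variables (mu : {measure set (borel M) -> \bar R}) (lam : nat -> R) (phi : nat -> M -> R).
Hypothesis hspec : spectral_resolution mu lam phi.

(** [r] plays the role of (-Delta - L) u.  When it is small, so are its Fourier
    coefficients in square mean: the spectral mass of [u] concentrates near [L],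
    where lambda^s is close to [L `^ s]. *)
Lemma quasimode s (L eta : R) (u r w : M -> R) : 0 < s < 1 -> 0 < L -> 0 < eta ->
  L2 mu u -> L2 mu r ->
  (forall k, inner mu r (phi k) = (lam k - L) * inner mu u (phi k)) ->
  is_frac_laplacian mu lam phi s u w ->
  `|inner mu u w - L `^ s * inner mu u u| <=
  L `^ s * (inner mu r r / (2 * eta * L ^+ 2) + eta / 2 * inner mu u u).
Proof.
move=> s01 L0 eta0 Lu Lr rk fw.
have s0 : s != 0 by case/andP: s01 => ? _; rewrite gt_eqF.
have c1 := frac_laplacian_inner hspec s0 Lu fw.
have c2 := parseval hspec Lu.
have c3 : `|\sum_(0 <= k < N) lam k `^ s * inner mu u (phi k) ^+ 2 -
    L `^ s * \sum_(0 <= k < N) inner mu u (phi k) ^+ 2| @[N --> \oo] -->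
    `|inner mu u w - L `^ s * inner mu u u|.
  by apply: cvg_norm; apply: cvgB => //; apply: cvgM => //; exact: cvg_cst.
rewrite -(cvg_lim (@Rhausdorff R) c3).
apply: limr_le; first by apply/cvg_ex; eexists; exact: c3.
apply: nearW => N; rewrite /= [X in `|_ - X|]mulr_sumr -sumrB.
apply: (le_trans (ler_norm_sum _ _ _)).
have Lu0 := bessel hspec N Lu; have Lr0 := bessel hspec N Lr.
apply: (@le_trans _ _ (L `^ s * ((\sum_(0 <= k < N) inner mu r (phi k) ^+ 2) / (2 * eta * L ^+ 2) +
    eta / 2 * \sum_(0 <= k < N) inner mu u (phi k) ^+ 2))).
  rewrite mulr_suml [in X in _ * (_ + X)]mulr_sumr -big_split mulr_sumr /=.
  apply: ler_sum => k _.
  rewrite -mulrBl normrM [X in _ * X]ger0_norm ?sqr_ge0//.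
  apply: (@le_trans _ _ (L `^ s * ((lam k - L) ^+ 2 / (2 * eta * L ^+ 2) + eta / 2) * inner mu u (phi k) ^+ 2)).
    by rewrite ler_wpM2r ?sqr_ge0// powR_close// (lam_ge0 hspec).
  rewrite le_eqVlt; apply/orP; left; apply/eqP; rewrite rk.
  by field; rewrite !gt_eqF.
rewrite ler_wpM2l ?powR_ge0// lerD//.
  rewrite ler_wpM2r// invr_ge0 mulr_ge0 ?sqr_ge0// mulr_ge0//; exact: ltW.
by rewrite ler_wpM2l// divr_ge0// ltW.
Qed.

End quasimode.

(** * Integration in a chart *)

Section transport.
Local Open Scope ereal_scope.
Context d1 d2 (X : measurableType d1) (Y : measurableType d2) (R : realType).
Variables (m1 : {measure set X -> \bar R}) (m2 : {measure set Y -> \bar R}).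
Variables (D : set X) (E : set Y) (phi : Y -> X) (q : Y -> R).
Hypotheses (mD : measurable D) (mE : measurable E).
Hypotheses (ED : forall y, E y -> D (phi y)) (mphi : measurable_fun E phi).
Hypotheses (mq : measurable_fun E q) (q0 : forall y, E y -> (0 <= q y)%R).
Hypothesis m1E : forall A, measurable A -> A `<=` D ->
  m1 A = \int[m2]_(y in E `&` phi @^-1` A) (q y)%:E.

Import HBNNSimple.

(** On [D], [m1] is the image by [phi] of the measure of density [q] with respect
    to [m2].  The formula is the hypothesis for indicator functions and extends
    to simple functions, then to their increasing limits. *)
Lemma ge0_integral_transport (f : X -> \bar R) :
  measurable_fun D f -> (forall x, D x -> 0 <= f x) ->
  \int[m1]_(x in D) f x = \int[m2]_(y in E) ((q y)%:E * f (phi y)).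
Proof.
move=> mf f0.
pose f_ := nnsfun_approx mD mf.
have mfphi n : measurable_fun E (fun y => f_ n (phi y)).
  exact: (measurableT_comp (f := f_ n)).
have mqE : measurable_fun E (EFin \o q) by exact/measurable_EFinP.
transitivity (limn (fun n => \int[m1]_(x in D) (f_ n x)%:E)).
  rewrite -monotone_convergence//.
  - apply: eq_integral => y /[!inE] yD; apply/esym/cvg_lim => //.
    exact: cvg_nnsfun_approx.
  - by move=> n; exact/measurable_EFinP/measurable_funTS.
  - by move=> n y _; rewrite lee_fin.
  - by move=> y _ m n mn; rewrite lee_fin; exact/lefP/nd_nnsfun_approx.
transitivity (limn (fun n => \int[m2]_(y in E) ((q y)%:E * (f_ n (phi y))%:E))); last first.
  rewrite -monotone_convergence//.
  - apply: eq_integral => y /[!inE] yE; apply/cvg_lim => //.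
    by apply: cvgeZl => //; apply: cvg_nnsfun_approx => //; exact: ED.
  - by move=> n; apply: emeasurable_funM => //; exact/measurable_EFinP.
  - by move=> n y Ey; rewrite mule_ge0// lee_fin// q0.
  - move=> y Ey m n mn; rewrite lee_wpmul2l// ?lee_fin ?q0//.
    exact/lefP/nd_nnsfun_approx.
congr (limn _); apply/funext => n; set g := f_ n.
have mi k : measurable_fun E (fun y => \1_(g @^-1` [set k]) (phi y) : measurableTypeR R).
  have mgk : measurable (g @^-1` [set k]) by [].
  by apply: (measurableT_comp (f := (\1_(g @^-1` [set k]) : X -> measurableTypeR R))) => //.
transitivity (\sum_(k \in range g) \int[m1]_(x in D) (k * \1_(g @^-1` [set k]) x)%:E).
  under eq_integral do rewrite fimfunE -fsumEFin//.
  rewrite ge0_integral_fsum//.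
    by move=> y; apply/measurable_EFinP; apply: measurable_funM => //; exact: measurable_funTS.
  by move=> y x _; rewrite nnfun_muleindic_ge0.
transitivity (\sum_(k \in range g) \int[m2]_(y in E) ((q y)%:E * (k * \1_(g @^-1` [set k]) (phi y))%:E)); last first.
  rewrite -ge0_integral_fsum//.
  - apply: eq_integral => y _; rewrite [in RHS]fimfunE -fsumEFin// ge0_mule_fsumr//.
    by move=> x; rewrite nnfun_muleindic_ge0.
  - move=> y; apply: emeasurable_funM => //; apply/measurable_EFinP.
    apply: measurable_funM => //.
    exact: mi.
  - by move=> y x Ex; rewrite mule_ge0 ?lee_fin ?q0// -lee_fin nnfun_muleindic_ge0.
apply: eq_fsbigr => k /[!inE] -[x0 _ gk].
have k0 : (0 <= k)%R by rewrite -gk.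
have mgk : measurable (g @^-1` [set k]) by [].
transitivity (k%:E * m1 (g @^-1` [set k] `&` D)).
  under eq_integral do rewrite EFinM.
  rewrite ge0_integralZl//.
  - by rewrite integral_indic.
  - by apply/measurable_EFinP; exact: measurable_funTS.
rewrite m1E//; last exact: measurableI.
transitivity (k%:E * \int[m2]_(y in E) ((q y)%:E * (\1_(g @^-1` [set k]) (phi y))%:E)).
  congr (_ * _); rewrite integral_mkcondr; apply: eq_integral => y /[!inE] Ey.
  rewrite patchE indicE.
  have [h|h] := boolP (y \in phi @^-1` (g @^-1` [set k] `&` D)).
    by rewrite mem_set ?mule1//; move: h; rewrite inE => -[].
  rewrite memNset ?mule0// => h1; move/negP: h; apply; rewrite inE; split => //; exact: ED.
rewrite -ge0_integralZl//.
- by apply: eq_integral => y _; rewrite EFinM muleCA.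
- apply: emeasurable_funM => //; apply/measurable_EFinP.
  exact: mi.
- by move=> y Ey; rewrite mule_ge0 ?lee_fin ?q0.
Qed.

Lemma integral_transport (f : X -> R) : measurable_fun D f ->
  \int[m1]_(x in D) (f x)%:E = \int[m2]_(y in E) (q y * f (phi y))%:E.
Proof.
move=> mf.
have mf' : measurable_fun D (EFin \o f) by exact/measurable_EFinP.
rewrite integralE [RHS]integralE; congr (_ - _).
- rewrite ge0_integral_transport//; last exact: measurable_funepos.
  apply: eq_integral => y /[!inE] Ey; rewrite !funeposE -EFin_max /= -EFin_max -EFinM.
  by rewrite maxr_pMr ?q0// mulr0.
- rewrite ge0_integral_transport//; last exact: measurable_funeneg.
  apply: eq_integral => y /[!inE] Ey; rewrite !funenegE -EFin_max /= -EFin_max -EFinM.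
  by rewrite maxr_pMr ?q0// mulr0 mulrN.
Qed.

End transport.

Section chart_integral.
Context {R : realType} {n : nat} (M : closedRiemannian R n).
Local Notation RT := (measurableTypeR R).
Local Notation leb := (@lebesgue_row R n).
Variable c : chart R n M.
Hypothesis Ac : atlas M c.

Lemma cdom_open : open (cdom c).
Proof. by have [] := atlas_chart (atlasP M) Ac. Qed.

Lemma cran_open : open (cran c).
Proof. by have [] := atlas_chart (atlasP M) Ac. Qed.

Lemma cmapK p : cdom c p -> cinv c (cmap c p) = p.
Proof. by have [_ _ + _ _] := atlas_chart (atlasP M) Ac; apply. Qed.

Lemma cmap_continuous : {in cdom c, continuous (cmap c)}.
Proof. by have [_ _ _ + _] := atlas_chart (atlasP M) Ac. Qed.

Lemma cinv_continuous : {in cran c, continuous (cinv c)}.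
Proof. by have [_ _ _ _ +] := atlas_chart (atlasP M) Ac. Qed.

Lemma cdom_cinv x : cran c x -> cdom c (cinv c x).
Proof. by move=> [p cp <-]; rewrite cmapK. Qed.

Lemma cinvK x : cran c x -> cmap c (cinv c x) = x.
Proof. by move=> [p cp <-]; rewrite cmapK. Qed.

Lemma cran_cmap p : cdom c p -> cran c (cmap c p).
Proof. by move=> cp; exists p. Qed.

Lemma measurable_cran : measurable (cran c : set (row_space R n)).
Proof. by apply: measurable_row_open; exact: cran_open. Qed.

Lemma measurable_cdom : measurable (cdom c : set (borel M)).
Proof. by apply: measurable_borel_open; exact: cdom_open. Qed.

Lemma open_cinv (A : set M) : open A -> open (cran c `&` cinv c @^-1` A).
Proof.
move=> oA; rewrite openE => x [cx Ax]; apply: filterI; first exact: open_nbhs_nbhs (conj cran_open cx).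
by apply: cinv_continuous; rewrite ?inE//; apply: open_nbhs_nbhs.
Qed.

Lemma measurable_cinv :
  measurable_fun (cran c : set (row_space R n)) (cinv c : row_space R n -> borel M).
Proof.
apply: (@measurability _ _ _ _ _ _ (@open M : set (set (borel M)))) => // _ [A oA <-].
by apply: measurable_row_open; exact: open_cinv.
Qed.

Lemma sqrt_det_ge0 x : 0 <= sqrt_det c x.
Proof. exact: sqrtr_ge0. Qed.

Variable mu : {measure set (borel M) -> \bar R}.
Hypothesis hmu : is_volume mu.
Hypothesis cq : {in cran c, continuous (sqrt_det c : _ -> R^o)}.

(** For indicator functions this is the definition of a volume measure; the
    general case follows by linearity and monotone limits. *)
Lemma chart_integral (F : M -> R) : measurable_fun (cdom c : set (borel M)) (F : borel M -> RT) ->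
  (forall p, ~ cdom c p -> F p = 0) ->
  (\int[mu]_x (F x)%:E = \int[leb]_(x in cran c) (sqrt_det c x * F (cinv c x))%:E)%E.
Proof.
move=> mF F0.
transitivity (\int[mu]_(x in cdom c) (F x)%:E)%E.
  rewrite [RHS]integral_mkcond; apply: eq_integral => p _; rewrite patchE.
  by case: ifPn => // /negP h; rewrite F0// => cp; apply: h; rewrite inE.
apply: (@integral_transport _ _ _ _ R mu leb (cdom c) (cran c) (cinv c) (sqrt_det c)) => //.
- exact: measurable_cdom.
- exact: measurable_cran.
- exact: cdom_cinv.
- exact: measurable_cinv.
- exact: (continuous_measurable_row cran_open cq).
- by move=> y _; exact: sqrt_det_ge0.
- move=> A mA Ac'; rewrite (hmu Ac mA Ac'); congr integral.
  apply/seteqP; split => x /=.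
    by move=> [p Ap <-]; have cp := Ac' _ Ap; split; [exact: cran_cmap|rewrite /preimage /= cmapK].
  by move=> [cx Ax]; exists (cinv c x) => //; exact: cinvK.
Qed.

(** Extension by zero from a chart to the manifold, meant for [U] supported in a
    compact part of the range of the chart. *)
Definition chart_lift (U : 'rV[R]_n -> R) : M -> R :=
  fun p => if p \in cdom c then U (cmap c p) else 0.

Lemma chart_liftE U x : cran c x -> chart_lift U (cinv c x) = U x.
Proof. by move=> cx; rewrite /chart_lift mem_set ?cinvK//; exact: cdom_cinv. Qed.

Lemma chart_lift_out U p : ~ cdom c p -> chart_lift U p = 0.
Proof. by move=> h; rewrite /chart_lift memNset. Qed.

Lemma measurable_chart_lift U : {in cran c, continuous (U : _ -> R^o)} ->
  measurable_fun setT (chart_lift U : borel M -> RT).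
Proof.
move=> cU.
rewrite (_ : chart_lift U = ((U \o cmap c) \_ (cdom c))); last first.
  by apply/funext => p; rewrite patchE.
apply: (measurable_restrictT _ _).1; first exact: measurable_cdom.
apply: continuous_measurable_borel; first exact: cdom_open.
move=> p cp; apply: continuous_comp; first exact: cmap_continuous.
by apply: cU; rewrite inE; apply: cran_cmap; rewrite inE in cp.
Qed.

Lemma inner_chart_lift U v : {in cran c, continuous (U : _ -> R^o)} ->
  measurable_fun setT (v : borel M -> RT) ->
  inner mu (chart_lift U) v =
  fine (\int[leb]_(x in cran c) (sqrt_det c x * (U x * v (cinv c x)))%:E)%E.
Proof.
move=> cU mv; rewrite /inner /Rintegral; congr fine.
rewrite chart_integral.
- by apply: eq_integral => x /[!inE] cx; rewrite chart_liftE.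
- apply: measurable_funM; apply: measurable_funTS => //; exact: measurable_chart_lift.
- by move=> p cp; rewrite chart_lift_out// mul0r.
Qed.

End chart_integral.

(** * Operators in divergence form *)

Section compact_support.
Context {R : realType} {n : nat}.
Local Notation leb := (@lebesgue_row R n).
Variables (W K : set 'rV[R]_n) (b : R).
Hypotheses (oW : open W) (cK : closed K) (KW : K `<=` W) (Kb : K `<=` row_cball b).
Implicit Types (F U V : 'rV[R]_n -> R).

Definition null_off F := forall x, ~ K x -> F x = 0.

Lemma null_off_Ml F U : null_off U -> null_off (fun x => F x * U x).
Proof. by move=> h x /h; rewrite /= => ->; rewrite mulr0. Qed.

Lemma null_off_Mr F U : null_off U -> null_off (fun x => U x * F x).
Proof. by move=> h x /h; rewrite /= => ->; rewrite mul0r. Qed.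

Lemma null_off_derive F v : null_off F -> null_off ('D_v (F : _ -> R^o)).
Proof.
move=> F0 x Kx; rewrite -(derive_cst (0 : R^o) x v).
apply: (@eq_on_derive _ _ _ (~` K)) => //; first exact: closed_openC.
by move=> y /[!inE] /F0.
Qed.

Lemma null_off_continuous F : {in W, continuous (F : _ -> R^o)} -> null_off F ->
  continuous (F : _ -> R^o).
Proof.
move=> cF F0 x; have [Wx|Wx] := pselect (W x); first by apply: cF; rewrite inE.
have Kx : ~ K x by move=> /KW.
apply: (@eq_on_continuous _ _ (~` K) (cst 0 : _ -> R^o)) => //; first exact: closed_openC.
  by move=> y /[!inE] /F0.
exact: cst_continuous.
Qed.

Lemma null_off_beyond F : null_off F -> vanishes_beyond b F.
Proof. by move=> F0 x bx; apply: F0 => /Kb; rewrite /row_cball /= leNgt bx. Qed.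

Lemma null_off_integrableT F : {in W, continuous (F : _ -> R^o)} -> null_off F ->
  leb.-integrable setT (EFin \o F).
Proof.
move=> cF F0.
by apply: (integrable_row (null_off_continuous cF F0) (null_off_beyond F0)).
Qed.

Lemma null_off_integrable F : {in W, continuous (F : _ -> R^o)} -> null_off F ->
  leb.-integrable W (EFin \o F).
Proof.
move=> cF F0; apply: (@integrableS _ _ _ leb setT) => //.
  exact: measurable_row_open.
exact: null_off_integrableT.
Qed.

Lemma null_off_integral F : null_off F ->
  (\int[leb]_(x in W) (F x)%:E = \int[leb]_x (F x)%:E)%E.
Proof.
move=> F0; rewrite integral_mkcond; apply: eq_integral => x _; rewrite patchE.
case: ifPn => // /negP h; rewrite F0// => /KW Wx; apply: h; by rewrite inE.
Qed.

Lemma Rintegral_derive0 F v : Ck 1 W (F : _ -> R^o) -> null_off F ->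
  \int[leb]_(x in W) 'D_v (F : _ -> R^o) x = 0.
Proof.
move=> [cF /(_ v) [dF [cDF _]]] F0; rewrite /Rintegral null_off_integral; last exact: null_off_derive.
rewrite (@integral_derive_eq0 _ _ b)//.
- exact: null_off_continuous.
- move=> x; have [Wx|Wx] := pselect (W x); first exact: dF.
  apply: (@eq_on_derivable _ _ _ (~` K) (cst 0)) => //; first exact: closed_openC.
    by move=> y /[!inE] /F0.
  by move=> /KW.
- by apply: null_off_continuous => //; exact: null_off_derive.
- exact: null_off_beyond.
Qed.

Lemma Rintegral_sum0 (I : Type) (r : seq I) (F : I -> 'rV[R]_n -> R) :
  (forall i, {in W, continuous (F i : _ -> R^o)}) -> (forall i, null_off (F i)) ->
  (forall i, \int[leb]_(x in W) F i x = 0) ->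
  \int[leb]_(x in W) (\sum_(i <- r) F i x) = 0.
Proof.
move=> cF F0 iF; elim: r => [|i r IH].
  under eq_Rintegral do rewrite big_nil.
  by rewrite Rintegral_cst ?mul0r//; exact: measurable_row_open.
under eq_Rintegral do rewrite big_cons.
rewrite RintegralD ?iF ?IH ?addr0//.
- exact: measurable_row_open.
- exact: null_off_integrable.
apply: null_off_integrable.
  have : Ck 0 W (fun x => \sum_(j <- r) F j x : R^o) by apply: Ck_sum => // j _; split => //; exact: cF.
  by case.
by move=> x Kx; rewrite big1// => j _; rewrite F0.
Qed.

Definition ei (i : 'I_n) : 'rV[R]_n := delta_mx ord0 i.

Variable P : 'I_n -> 'I_n -> 'rV[R]_n -> R.
Hypothesis CP : forall i j, Ck 1 W (P i j : _ -> R^o).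
Hypothesis symP : forall i j x, W x -> P i j x = P j i x.

(** For P^{ij} = sqrt (det g) g^{ij}, [divflux] is sqrt (det g) Delta_g. *)
Definition flux U (i : 'I_n) : 'rV[R]_n -> R :=
  fun y => \sum_j P i j y * 'D_(ei j) (U : _ -> R^o) y.

Definition divflux U : 'rV[R]_n -> R :=
  fun x => \sum_i 'D_(ei i) (flux U i : _ -> R^o) x.

Lemma Ck_flux U i : Ck 2 W (U : _ -> R^o) -> Ck 1 W (flux U i : _ -> R^o).
Proof.
move=> [_ CU]; apply: Ck_sum => // j _.
by apply: (CkM oW (CP i j)); exact: (CU (ei j)).2.
Qed.

Lemma divflux_continuous U : Ck 2 W (U : _ -> R^o) ->
  {in W, continuous (divflux U : _ -> R^o)}.
Proof.
move=> CU; have : Ck 0 W (divflux U : _ -> R^o).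
  by apply: Ck_sum => // i _; have [_ /(_ (ei i))[]] := Ck_flux i CU.
by case.
Qed.

Lemma null_off_flux U i : null_off U -> null_off (flux U i).
Proof.
move=> U0 x Kx; rewrite /flux big1// => j _.
by rewrite (null_off_derive _ U0)// mulr0.
Qed.

Lemma null_off_divflux U : null_off U -> null_off (divflux U).
Proof.
move=> U0 x Kx; rewrite /divflux big1// => i _.
by rewrite (null_off_derive _ (null_off_flux i U0)).
Qed.

Lemma green_sum (a b' c d : 'I_n -> R) (u v : R) :
  \sum_i c i = \sum_i d i ->
  \sum_i (v * a i - u * b' i + (c i - d i)) = v * \sum_i a i - u * \sum_i b' i.
Proof. by move=> cd; rewrite big_split /= !sumrB cd subrr addr0 -!mulr_sumr. Qed.

(** The terms P(dU, dV) produced by the product rule cancel by symmetry of [P]. *)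
Lemma green_pointwise U V x : Ck 2 W (U : _ -> R^o) -> Ck 2 W (V : _ -> R^o) -> W x ->
  \sum_i 'D_(ei i) (fun y => V y * flux U i y - U y * flux V i y : R^o) x =
  V x * divflux U x - U x * divflux V x.
Proof.
move=> CU CV Wx.
have dU v : derivable (U : _ -> R^o) x v by have [_ /(_ v)[+ _]] := CU; apply.
have dV v : derivable (V : _ -> R^o) x v by have [_ /(_ v)[+ _]] := CV; apply.
have dfU i v : derivable (flux U i : _ -> R^o) x v by have [_ /(_ v)[+ _]] := Ck_flux i CU; apply.
have dfV i v : derivable (flux V i : _ -> R^o) x v by have [_ /(_ v)[+ _]] := Ck_flux i CV; apply.
rewrite (eq_bigr (fun i => (V x * 'D_(ei i) (flux U i : _ -> R^o) x - U x * 'D_(ei i) (flux V i : _ -> R^o) x)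
   + (flux U i x * 'D_(ei i) (V : _ -> R^o) x - flux V i x * 'D_(ei i) (U : _ -> R^o) x))); last first.
  move=> i _.
  have h1 := derivableM (dV (ei i)) (dfU i (ei i)).
  have h2 := derivableM (dU (ei i)) (dfV i (ei i)).
  rewrite (derive_sub h1 h2) (derive_mul (dV _) (dfU i _)) (derive_mul (dU _) (dfV i _)).
  by rewrite opprD addrACA.
apply: (@green_sum (fun i => 'D_(ei i) (flux U i : _ -> R^o) x) (fun i => 'D_(ei i) (flux V i : _ -> R^o) x)
  (fun i => flux U i x * 'D_(ei i) (V : _ -> R^o) x) (fun i => flux V i x * 'D_(ei i) (U : _ -> R^o) x)).
rewrite /flux; under eq_bigr do rewrite mulr_suml.
rewrite exchange_big; apply: eq_bigr => i _; rewrite mulr_suml; apply: eq_bigr => j _.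
by rewrite symP// mulrAC.
Qed.

(** The vector field V flux(U) - U flux(V) vanishes off [K] along with [U], hence
    its divergence has integral zero. *)
Lemma green U V : Ck 2 W (U : _ -> R^o) -> Ck 2 W (V : _ -> R^o) -> null_off U ->
  \int[leb]_(x in W) (V x * divflux U x) = \int[leb]_(x in W) (U x * divflux V x).
Proof.
move=> CU CV U0; apply/eqP; rewrite -subr_eq0; apply/eqP.
have mW : measurable (W : set (row_space R n)) by exact: measurable_row_open.
rewrite -RintegralB//; last 2 first.
- apply: null_off_integrable; last by apply: null_off_Ml; exact: null_off_divflux.
  by apply: in_continuousM; [exact: (Ck_continuous CV)|exact: divflux_continuous].
- apply: null_off_integrable; last exact: null_off_Mr.
  by apply: in_continuousM; [exact: (Ck_continuous CU)|exact: divflux_continuous].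
pose F i : 'rV[R]_n -> R := fun y => V y * flux U i y - U y * flux V i y.
have F0 i : null_off (F i).
  by move=> x Kx; rewrite /F (null_off_flux i U0)// U0// mulr0 mul0r subrr.
have CF i : Ck 1 W (F i : _ -> R^o).
  have CN : Ck 1 W (fun y => -1 * (U y * flux V i y) : R^o).
    by apply: (CkM oW (Ck_cst 1 W (-1 : R^o))); apply: (CkM oW (Ck_S CU)); exact: Ck_flux.
  apply: Ck_eq (CkD oW (CkM oW (Ck_S CV) (Ck_flux i CU)) CN) => //.
  by move=> x _; rewrite /F /= mulN1r.
rewrite (@eq_Rintegral _ _ _ leb W (fun x => \sum_i 'D_(ei i) (F i : _ -> R^o) x)); last first.
  by move=> x /[!inE] Wx; rewrite green_pointwise.
apply: Rintegral_sum0.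
- by move=> i; have [_ /(_ (ei i))[_ []]] := CF i.
- by move=> i; exact: null_off_derive.
- by move=> i; exact: Rintegral_derive0.
Qed.

End compact_support.

(** * Positive definite matrices *)

Section positive_definite.
Context {R : realType}.

Definition posdef n (A : 'M[R]_n) := forall v : 'rV[R]_n, v != 0 -> 0 < (v *m A *m v^T) ord0 ord0.

Lemma sqnorm_ge0 n (v : 'rV[R]_n) : 0 <= (v *m v^T) ord0 ord0.
Proof. by rewrite mxE sumr_ge0// => i _; rewrite mxE -expr2 sqr_ge0. Qed.

(** The polynomial det (x + A) tends to +oo and has no root x >= 0, because x + A
    is then positive definite; by the intermediate value theorem it is positive
    at 0. *)
Lemma posdef_det n (A : 'M[R]_n) : posdef A -> 0 < \det A.
Proof.
move=> pA; pose p := char_poly (- A).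
have pE x : p.[x] = \det (x%:M + A).
  rewrite /p /char_poly -[LHS]/(horner_eval x _) -det_map_mx; congr (\det _).
  apply/matrixP => i j; rewrite 2!mxE [LHS]/= /horner_eval hornerD !mxE.
  by rewrite hornerMn hornerX hornerN hornerC opprK.
have nroot x : 0 <= x -> p.[x] != 0.
  move=> x0; rewrite pE; apply/det0P => -[v v0 vA].
  have := pA v v0.
  have : (v *m (x%:M + A) *m v^T) ord0 ord0 = 0 by rewrite vA mul0mx mxE.
  rewrite mulmxDr mulmxDl mxE mul_mx_scalar -scalemxAl mxE => h.
  have := sqnorm_ge0 v; nra.
have p0 : p.[0] = \det A by rewrite pE raddf0 add0r.
rewrite -p0 lt0r nroot//= leNgt; apply/negP => pn.
have lc : 0 < lead_coef p by rewrite (monicP (char_poly_monic _)) ltr01.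
have [N hN] := poly_pinfty_gt_lc lc.
have [||x /andP[x0 _]] := @poly_ivt R p 0 (Num.max N 0).
- by rewrite le_max lexx orbT.
- rewrite ltW//=; apply: le_trans (ltW lc) (hN _ _).
  by rewrite le_max lexx.
by rewrite /root; apply/negP; exact: nroot.
Qed.

Lemma posdef_unit n (A : 'M[R]_n) : posdef A -> A \in unitmx.
Proof. by move=> /posdef_det pA; rewrite unitmxE unitfE gt_eqF. Qed.

Lemma posdef_inv n (A : 'M[R]_n) : A^T = A -> posdef A -> posdef (invmx A).
Proof.
move=> sA pA v v0; have uA := posdef_unit pA.
have -> : v *m invmx A *m v^T = (v *m invmx A) *m A *m (v *m invmx A)^T.
  by rewrite trmx_mul trmx_inv sA mulmxKV// mulmxA.
apply: pA; apply: contra v0 => /eqP h.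
by rewrite -[v](mulmxKV uA) h mul0mx.
Qed.

End positive_definite.

Section Ck_matrix.
Context {R : realType} {V : normedModType R}.
Variables (W : set V) (k : nat).
Hypothesis oW : open W.

Lemma Ck_det m (A : V -> 'M[R]_m) :
  (forall i j, Ck k W (fun x => A x i j : R^o)) -> Ck k W (fun x => \det (A x) : R^o).
Proof.
move=> CA; apply: Ck_sum => // s _.
by apply: (CkM oW (Ck_cst k W _)); apply: Ck_prod.
Qed.

Lemma Ck_invmx m (A : V -> 'M[R]_m) i j :
  (forall i j, Ck k W (fun x => A x i j : R^o)) -> (forall x, W x -> A x \in unitmx) ->
  Ck k W (fun x => invmx (A x) i j : R^o).
Proof.
move=> CA uA.
have C1 : Ck k W (fun x => (\det (A x))^-1 : R^o).
  apply: (Ck_comp1 (f := fun x => \det (A x) : R^o) (I := [set x : R^o | x != 0])) => //.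
  - by move=> x /uA; rewrite unitmxE unitfE.
  - exact: Ck_det.
  - exact: Ck_inv.
have C2 : Ck k W (fun x => (-1) ^+ (j + i) * \det (row' j (col' i (A x))) : R^o).
  apply: (CkM oW (Ck_cst k W _)); apply: Ck_det => a b.
  have E : (fun x => A x (lift j a) (lift i b)) = (fun x => row' j (col' i (A x)) a b).
    by apply/funext => x; rewrite !mxE.
  by have := CA (lift j a) (lift i b); rewrite E.
apply: Ck_eq (CkM oW C1 C2) => // x /[!inE] /uA uAx /=.
by rewrite /invmx uAx !mxE.
Qed.

End Ck_matrix.

(** * The Laplacian in a chart *)

Lemma residual_weight (R : realType) (q d u v L : R) : q != 0 ->
  q * ((- (q^-1 * d) - L * u) * v) = -1 * (v * d) + - L * (q * (u * v)).
Proof. by move=> q0; field. Qed.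

Lemma Rintegral_comb d (T : measurableType d) (R : realType) (mu : {measure set T -> \bar R})
    (D : set T) (f g : T -> R) (a b : R) : measurable D ->
  mu.-integrable D (EFin \o f) -> mu.-integrable D (EFin \o g) ->
  \int[mu]_(x in D) (a * f x + b * g x) =
  a * \int[mu]_(x in D) f x + b * \int[mu]_(x in D) g x.
Proof.
move=> mD i_f ig; rewrite RintegralD//; first by rewrite !RintegralZl.
- exact: (integrableZl mD a i_f).
- exact: (integrableZl mD b ig).
Qed.

Section chart_geometry.
Context {R : realType} {n : nat} (M : closedRiemannian R n).
Local Notation leb := (@lebesgue_row R n).
Variable c : chart R n M.
Hypothesis Ac : atlas M c.
Let W : set 'rV[R]_n := cran c.
Let oW : open W := cran_open Ac.

Lemma metric_posdef x : W x -> posdef (metric c x).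
Proof. by move=> Wx v; exact: (metric_pos (metricP M) Ac). Qed.

Lemma metric_unit x : W x -> metric c x \in unitmx.
Proof. by move=> /metric_posdef/posdef_unit. Qed.

Lemma sqrt_det_gt0 x : W x -> 0 < sqrt_det c x.
Proof. by move=> Wx; rewrite sqrtr_gt0; exact/posdef_det/metric_posdef. Qed.

Lemma Ck_sqrt_det : Ck 2 W (sqrt_det c : _ -> R^o).
Proof.
apply: (Ck_comp1 (f := fun x => \det (metric c x) : R^o) (I := [set x : R^o | 0 < x])) => //.
- by move=> x Wx /=; exact/posdef_det/metric_posdef.
- by apply: Ck_det => // i j; exact: (metric_C2 (metricP M) Ac).
- exact: Ck_sqrt.
Qed.

Definition coef (i j : 'I_n) (x : 'rV[R]_n) : R := sqrt_det c x * invmx (metric c x) i j.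

Lemma Ck_invmetric i j : Ck 2 W (fun x => invmx (metric c x) i j : R^o).
Proof.
apply: Ck_invmx => //; last by move=> x; exact: metric_unit.
by move=> a b; exact: (metric_C2 (metricP M) Ac).
Qed.

Lemma Ck_coef i j : Ck 2 W (coef i j : _ -> R^o).
Proof. exact: (CkM oW Ck_sqrt_det (Ck_invmetric i j)). Qed.

Lemma coef_sym i j x : W x -> coef i j x = coef j i x.
Proof.
move=> Wx; rewrite /coef; congr (_ * _).
have /matrixP/(_ j i) : (invmx (metric c x))^T = invmx (metric c x).
  by rewrite trmx_inv (Defs.metric_sym (metricP M) Ac).
by rewrite mxE.
Qed.

Lemma laplacianE (u : M -> R) x :
  laplacian c u x = (sqrt_det c x)^-1 * divflux coef (u \o cinv c) x.
Proof.
rewrite /laplacian /divflux; congr (_ * _); apply: eq_bigr => i _.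
have -> : flux coef (u \o cinv c) i = (fun y => sqrt_det c y *
    \sum_(j < n) invmx (metric c y) i j * 'D_(ei j) (u \o cinv c : _ -> R^o) y).
  by apply/funext => y; rewrite /flux mulr_sumr; apply: eq_bigr => j _; rewrite /coef mulrA.
by [].
Qed.

Lemma eigen_divflux (l : R) (phi : M -> R) x : eigenfunction l phi -> W x ->
  divflux coef (phi \o cinv c) x = - l * (sqrt_det c x * phi (cinv c x)).
Proof.
move=> [_ /(_ c Ac x) + Wx] => /(_ Wx); rewrite laplacianE => h.
have q0 : sqrt_det c x != 0 by rewrite gt_eqF// sqrt_det_gt0.
rewrite mulNr mulrCA -h mulrN mulVKf// opprK//.
Qed.

Variables (K : set 'rV[R]_n) (b : R).
Hypotheses (cK : closed K) (KW : K `<=` W) (Kb : K `<=` row_cball b).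
Variable mu : {measure set (borel M) -> \bar R}.
Hypothesis hmu : is_volume mu.
Implicit Types (U F G : 'rV[R]_n -> R).

Let cq : {in W, continuous (sqrt_det c : _ -> R^o)} := Ck_continuous Ck_sqrt_det.

Lemma inner_chart_lift2 F G : {in W, continuous (F : _ -> R^o)} -> {in W, continuous (G : _ -> R^o)} ->
  inner mu (chart_lift c F) (chart_lift c G) = \int[leb]_(x in W) (sqrt_det c x * (F x * G x)).
Proof.
move=> cF cG; rewrite inner_chart_lift//; last exact: measurable_chart_lift.
by apply: eq_Rintegral => x /[!inE] Wx; rewrite (chart_liftE Ac).
Qed.

Lemma L2_chart_lift F : {in W, continuous (F : _ -> R^o)} -> null_off K F ->
  L2 mu (chart_lift c F).
Proof.
move=> cF F0; have mF := measurable_chart_lift Ac cF.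
apply: L2P => //.
rewrite (chart_integral Ac hmu cq); last 2 first.
- by apply: measurable_funTS; exact: measurable_funX.
- by move=> p cp; rewrite chart_lift_out// expr0n.
rewrite (eq_integral (fun x : row_space R n => (sqrt_det c x * (F x * F x))%:E)); last first.
  by move=> x /[!inE] Wx; rewrite (chart_liftE Ac)// expr2.
apply: integrable_lty => //; first exact: (measurable_cran Ac).
apply: (null_off_integrable (K := K) (b := b)) => //.
  by do 2 apply: in_continuousM => //.
by apply: null_off_Ml; exact: null_off_Ml.
Qed.

(** The coordinate expression of (-Delta - L) U. *)
Definition residual (L : R) U : 'rV[R]_n -> R :=
  fun x => - ((sqrt_det c x)^-1 * divflux coef U x) - L * U x.

Lemma null_off_residual L U : null_off K U -> null_off K (residual L U).
Proof.
move=> U0 x Kx; rewrite /residual (null_off_divflux cK _ U0)// U0//.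
by rewrite !mulr0 !oppr0 addr0.
Qed.

Lemma inv_sqrt_det_continuous : {in W, continuous ((fun x => (sqrt_det c x)^-1) : _ -> R^o)}.
Proof.
move=> x Wx; apply: continuous_comp; first exact: cq.
by apply: inv_continuous; rewrite gt_eqF// sqrt_det_gt0//; rewrite inE in Wx.
Qed.

Lemma residual_continuous L U : Ck 2 W (U : _ -> R^o) ->
  {in W, continuous (residual L U : _ -> R^o)}.
Proof.
move=> CU.
have h1 : {in W, continuous ((fun x => -1 * ((sqrt_det c x)^-1 * divflux coef U x)) : _ -> R^o)}.
  apply: in_continuousM; first by move=> x _; exact: cst_continuous.
  apply: in_continuousM; first exact: inv_sqrt_det_continuous.
  by apply: (divflux_continuous oW) => // i j; exact/Ck_S/Ck_coef.
have h2 : {in W, continuous ((fun x => - L * U x) : _ -> R^o)}.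
  apply: in_continuousM; first by move=> x _; exact: cst_continuous.
  exact: (Ck_continuous CU).
rewrite (_ : residual L U = (fun x => -1 * ((sqrt_det c x)^-1 * divflux coef U x) + - L * U x)).
  exact: in_continuousD.
by apply/funext => x; rewrite /residual mulN1r mulNr.
Qed.

(** Green's identity moves the Laplacian from [U] to the eigenfunction. *)
Lemma residual_inner (l L : R) (phi : M -> R) U :
  Ck 2 W (U : _ -> R^o) -> null_off K U -> eigenfunction l phi ->
  inner mu (chart_lift c (residual L U)) phi = (l - L) * inner mu (chart_lift c U) phi.
Proof.
move=> CU U0 ephi.
have CV : Ck 2 W (phi \o cinv c : _ -> R^o) by case: ephi => + _; apply.
have mphi : measurable_fun setT (phi : borel M -> measurableTypeR R).
  by case: ephi => Cp _; exact: Ck_fun_measurable Cp.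
have CP i j : Ck 1 W (coef i j : _ -> R^o) by exact/Ck_S/Ck_coef.
have mW := measurable_cran Ac.
rewrite !(inner_chart_lift Ac hmu cq) //; last 2 first.
- exact: (Ck_continuous CU).
- exact: residual_continuous.
pose V := phi \o cinv c.
have iUV : leb.-integrable W (EFin \o (fun x => sqrt_det c x * (U x * V x))).
  apply: (null_off_integrable (K := K) (b := b)) => //.
    by do 2 apply: in_continuousM => //; [exact: (Ck_continuous CU)|exact: (Ck_continuous CV)].
  by apply: null_off_Ml; exact: null_off_Mr.
have iVU : leb.-integrable W (EFin \o (fun x => V x * divflux coef U x)).
  apply: (null_off_integrable (K := K) (b := b)) => //.
    apply: in_continuousM; first exact: (Ck_continuous CV).
    exact: (divflux_continuous oW CP CU).
  by apply: null_off_Ml; exact: null_off_divflux.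
have G := green oW cK KW Kb CP coef_sym CU CV U0.
transitivity (\int[leb]_(x in W) (- 1 * (V x * divflux coef U x) + (- L) * (sqrt_det c x * (U x * V x)))).
  by apply: eq_Rintegral => x /[!inE] Wx; exact: (residual_weight _ _ _ _ (lt0r_neq0 (sqrt_det_gt0 Wx))).
rewrite (Rintegral_comb _ _ mW iVU iUV) G mulrBl -mulNr; congr (_ + _).
transitivity (- 1 * \int[leb]_(x in W) (- l * (sqrt_det c x * (U x * V x)))).
  congr (_ * _); apply: eq_Rintegral => x /[!inE] Wx.
  by rewrite (eigen_divflux ephi Wx) mulrCA; congr (_ * _); rewrite mulrCA.
by rewrite (RintegralZl _ mW iUV) mulN1r mulNr opprK.
Qed.

End chart_geometry.

(** * Wave packets *)

Lemma flux_product_rule (R : comPzRingType) (t p c x w w' d : R) :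
  p * (c * (t * x * w') + w * d) = p * d * w + t * (p * x * c * w').
Proof. by ring. Qed.

Lemma divflux_product_rule (R : comPzRingType) (t u v w w' r f c z : R) :
  f * (t * z * w) + w' * u + (t * (r * c * (t * z * - w') + w * v) + r * c * w * 0) =
  (u - t ^+ 2 * (z * r * c)) * w' + t * (z * f + v) * w.
Proof. by ring. Qed.

Section wave_packet.
Context {R : realType} {n : nat}.
Variables (xi : 'rV[R]_n) (t : R).

Definition phase (x : 'rV[R]_n) : R := \sum_i xi ord0 i * x ord0 i.

(** The shift [a] of the argument makes this family of plane waves closed under
    differentiation: a derivative adds pi/2 to [a]. *)
Definition wave (a : R) (x : 'rV[R]_n) : R := cos (t * phase x + a).

Lemma is_derive_phase x v : is_derive x v (phase : _ -> R^o) (phase v).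
Proof.
have h : (fun h : R^o => h^-1 *: (((phase : _ -> R^o) \o shift x) (h *: v) - phase x)) @ 0^' --> (phase v : R^o).
  apply: cvg_trans (@cvg_cst _ (phase v : R^o) _ (0 : R^o)^' _); apply: near_eq_cvg; near=> h.
  have h0 : h != 0 by near: h; exact: nbhs_dnbhs_neq.
  rewrite /= /phase -sumrB [in RHS](eq_bigr (fun i => h * (xi ord0 i * v ord0 i))); last first.
    by move=> i _; rewrite !mxE; ring.
  by rewrite -mulr_sumr [_ *: _]mulKf.
by apply: DeriveDef; [apply/cvg_ex; exists (phase v)|exact/cvg_lim].
Unshelve. all: by end_near. Qed.

Lemma phase_ei j : phase (ei j) = xi ord0 j.
Proof.
rewrite /phase (bigD1 j)//= big1 ?addr0; last first.
  by move=> i ij; rewrite mxE eqxx (negbTE ij) mulr0.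
by rewrite mxE !eqxx mulr1.
Qed.

Lemma is_derive_wave a x j :
  is_derive x (ei j) (wave a : _ -> R^o) (t * xi ord0 j * wave (a + pi / 2) x).
Proof.
have h : is_derive x (ei j) (fun y => t * phase y + a : R^o) (t * xi ord0 j).
  have h1 := is_deriveZ t (is_derive_phase x (ei j)).
  have h2 := is_deriveD h1 (is_derive_cst (a : R^o) x (ei j)).
  by apply: (is_derive_eq h2); rewrite phase_ei addr0.
have [d D] := h.
have dc : derivable (@cos R : R^o -> R^o) (t * phase x + a) 1 by have [] := is_derive_cos (t * phase x + a).
have [d1 D1] := derive_comp1 d dc.
apply: DeriveDef => //; rewrite [LHS]D1 D.
have [_ ->] := is_derive_cos (t * phase x + a).
by rewrite mulrC /wave addrA cosDpihalf.
Qed.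

Lemma wave_pi a x : wave (a + pi / 2 + pi / 2) x = - wave a x.
Proof. by rewrite /wave -addrA -splitr addrA cosDpi. Qed.

(** The oscillating parts of the squared norms of the packets of phases 0 and
    pi/2 cancel exactly. *)
Lemma wave_sqr x : wave 0 x ^+ 2 + wave (pi / 2) x ^+ 2 = 1.
Proof. by rewrite /wave addr0 cosDpihalf sqrrN cos2Dsin2. Qed.

(** The composition with [T] allows for a change of chart. *)
Lemma Ck_wave {V : normedModType R} k (U : set V) (T : V -> 'rV[R]_n) a : open U ->
  Ck k U T -> Ck k U (fun x => wave a (T x) : R^o).
Proof.
move=> oU CT.
apply: (Ck_comp1 (f := fun x => t * phase (T x) + a : R^o) (I := setT) (g := @cos R)) => //.
- exact: openT.
- apply: (CkD oU _ (Ck_cst k U (a : R^o))).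
  apply: (CkM oU (Ck_cst k U (t : R^o))).
  apply: Ck_sum => // i _.
  exact: (CkM oU (Ck_cst k U (xi ord0 i : R^o)) (Ck_coord i oU CT)).
- exact: (Ck_cos_sin k).1.
Qed.

Variables (W : set 'rV[R]_n) (P : 'I_n -> 'I_n -> 'rV[R]_n -> R).
Hypothesis oW : open W.
Hypothesis CP : forall i j, Ck 1 W (P i j : _ -> R^o).

Definition packet (chi : 'rV[R]_n -> R) (a : R) (x : 'rV[R]_n) : R := chi x * wave a x.

(** For P^{ij} = sqrt (det g) g^{ij}, the geodesics issued from the covector [xi]
    leave in the direction of [ray], and [symbol] is the principal symbol of
    - sqrt (det g) Delta_g. *)
Definition ray i (x : 'rV[R]_n) : R := \sum_j P i j x * xi ord0 j.

Definition symbol (x : 'rV[R]_n) : R := \sum_i xi ord0 i * ray i x.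

Lemma Ck_ray i : Ck 1 W (ray i : _ -> R^o).
Proof.
apply: Ck_sum => // j _.
by have := CkM oW (CP i j) (Ck_cst 1 W (xi ord0 j : R^o)).
Qed.

(** What the amplitude undergoes along the rays: the part of the operator which
    is of order one in the frequency. *)
Definition transport_term (chi : 'rV[R]_n -> R) (x : 'rV[R]_n) : R :=
  \sum_i (xi ord0 i * flux P chi i x + 'D_(ei i) (fun y => ray i y * chi y : R^o) x).

Lemma flux_packet chi a i y : Ck 2 W (chi : _ -> R^o) -> W y ->
  flux P (packet chi a) i y =
  flux P chi i y * wave a y + t * (ray i y * chi y * wave (a + pi / 2) y).
Proof.
move=> Cchi Wy; rewrite /flux /ray !mulr_suml mulr_sumr -big_split; apply: eq_bigr => j _ /=.
have [dw Dw] := is_derive_wave a y j.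
have dchi : derivable (chi : _ -> R^o) y (ei j) by have [_ /(_ (ei j))[+ _]] := Cchi; apply.
rewrite (derive_mul dchi dw) Dw.
exact: flux_product_rule.
Qed.

(** Two derivatives falling on the wave give the term in t^2, one gives the term
    in t, and none gives the divergence of the flux of the amplitude. *)
Lemma divflux_packet chi a x : Ck 2 W (chi : _ -> R^o) -> W x ->
  divflux P (packet chi a) x =
  (divflux P chi x - t ^+ 2 * (symbol x * chi x)) * wave a x +
  t * transport_term chi x * wave (a + pi / 2) x.
Proof.
move=> Cchi Wx.
rewrite /divflux /symbol /transport_term !mulr_suml !mulr_sumr.
rewrite -sumrB !mulr_suml -big_split; apply: eq_bigr => i _ /=.
have [dw Dw] := is_derive_wave a x i.
have [dw' Dw'] := is_derive_wave (a + pi / 2) x i.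
have dflux : derivable (flux P chi i : _ -> R^o) x (ei i).
  by have [_ /(_ (ei i))[+ _]] := Ck_flux oW CP i Cchi; apply.
have drc : derivable (fun y => ray i y * chi y : R^o) x (ei i).
  by have [_ /(_ (ei i))[+ _]] := CkM oW (Ck_ray i) (Ck_S Cchi); apply.
have drcw : derivable (fun y => ray i y * chi y * wave (a + pi / 2) y : R^o) x (ei i) by exact: (derivableM drc dw').
have -> : 'D_(ei i) (flux P (packet chi a) i : _ -> R^o) x =
  'D_(ei i) (fun y => flux P chi i y * wave a y + t * (ray i y * chi y * wave (a + pi / 2) y) : R^o) x.
  by apply: (eq_on_derive _ oW) => // y /[!inE] Wy; rewrite flux_packet.
rewrite [LHS](deriveD (derivableM dflux dw) (derivableM (derivable_cst (t : R^o) x (ei i)) drcw)).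
rewrite (derive_mul dflux dw) (derive_mul (derivable_cst (t : R^o) x (ei i)) drcw) derive_cst.
rewrite (derive_mul drc dw') Dw Dw' wave_pi.
exact: divflux_product_rule.
Qed.

Variable K : set 'rV[R]_n.
Hypothesis cK : closed K.

Lemma null_off_transport chi : null_off K chi -> null_off K (transport_term chi).
Proof.
move=> c0 x Kx; rewrite /transport_term big1// => i _.
rewrite (null_off_flux cK _ _ c0)// mulr0 add0r.
by apply: (null_off_derive cK) => //; exact: null_off_Ml.
Qed.

Lemma transport_continuous chi : Ck 2 W (chi : _ -> R^o) ->
  {in W, continuous (transport_term chi : _ -> R^o)}.
Proof.
move=> Cchi; have : Ck 0 W (transport_term chi : _ -> R^o).
  apply: Ck_sum => // i _; apply: CkD => //.
    exact: (CkM oW (Ck_cst 0 W (xi ord0 i : R^o)) (Ck_S (Ck_flux oW CP i Cchi))).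
  by have [_ /(_ (ei i))[]] := CkM oW (Ck_ray i) (Ck_S Cchi).
by case.
Qed.

Lemma null_off_packet chi a : null_off K chi -> null_off K (packet chi a).
Proof. by move=> c0; exact: null_off_Mr. Qed.

Lemma Ck_packet chi a : Ck 2 W (chi : _ -> R^o) -> Ck 2 W (packet chi a : _ -> R^o).
Proof.
move=> Cchi; apply: (CkM oW Cchi).
by apply: (Ck_wave (T := id)) => //; apply: Ck_sub (@Ck_id _ _ 2).
Qed.

End wave_packet.

Section bump.
Context {R : realType} {n : nat}.
Variables (x0 : 'rV[R]_n) (delta : R).

(** A Euclidean ball is contained in the ball of the same radius for the
    maximum norm, which is the norm of ['rV[R]_n]. *)
Definition bump (x : 'rV[R]_n) : R :=
  flat 0 (delta ^+ 2 - \sum_i (x ord0 i - x0 ord0 i) ^+ 2).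

Lemma Ck_bump {V : normedModType R} k (U : set V) (T : V -> 'rV[R]_n) : open U ->
  Ck k U T -> Ck k U (fun x => bump (T x) : R^o).
Proof.
move=> oU CT.
apply: (Ck_comp1 (f := fun x => delta ^+ 2 - \sum_i (T x ord0 i - x0 ord0 i) ^+ 2 : R^o) (I := setT) (g := @flat R 0)) => //.
- exact: openT.
- have Ci i : Ck k U (fun x => T x ord0 i + (- x0 ord0 i) : R^o).
    exact: (CkD oU (Ck_coord i oU CT) (Ck_cst k U (- x0 ord0 i : R^o))).
  have CS : Ck k U (fun x => \sum_i (-1 * ((T x ord0 i + (- x0 ord0 i)) * (T x ord0 i + (- x0 ord0 i)))) : R^o).
    by apply: Ck_sum => // i _; exact: (CkM oU (Ck_cst k U (-1 : R^o)) (CkM oU (Ci i) (Ci i))).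
  apply: (Ck_eq oU _ (CkD oU (Ck_cst k U (delta ^+ 2 : R^o)) CS)).
  move=> x _; rewrite /= -sumrN; congr (_ + _).
  by apply: eq_bigr => i _; rewrite mulN1r expr2.
- exact: Ck_flat.
Qed.

Definition bump_supp : set 'rV[R]_n := [set x | `|x - x0| <= delta].

Lemma bump_null : 0 <= delta -> null_off bump_supp bump.
Proof.
move=> d0 x h; apply: flat_le0.
have [i hi] : exists i, delta < `|(x - x0) ord0 i|.
  apply/existsP; rewrite -[X in is_true X]negbK; apply/negP => /existsPn H.
  by apply: h; apply/row_norm_leP => // i; rewrite leNgt H.
rewrite subr_le0 (bigD1 i)//=; apply: (@le_trans _ _ ((x ord0 i - x0 ord0 i) ^+ 2)).
  by rewrite !mxE in hi; rewrite -[leRHS]real_normK ?num_real// lerXn2r ?nnegrE// ltW.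
by rewrite lerDl sumr_ge0// => j _; exact: sqr_ge0.
Qed.

Lemma bump_gt0 : 0 < delta -> 0 < bump x0.
Proof.
move=> d0; apply: flat_gt0; rewrite big1 ?subr0 ?exprn_gt0// => i _.
by rewrite subrr expr0n.
Qed.

Lemma Ck_bumpT k (W : set 'rV[R]_n) : open W -> Ck k W (bump : _ -> R^o).
Proof.
by move=> oW; apply: (Ck_bump (T := id)) => //; apply: Ck_sub (@Ck_id _ _ k).
Qed.

Lemma bump_supp_closed : closed bump_supp.
Proof.
rewrite (_ : bump_supp = (fun x => x + (- x0)) @^-1` (row_cball delta)) //.
apply: closed_comp; first by move=> x _; exact: continuous_row_shift.
by rewrite row_cballE; apply: open_closedC; exact: open_beyond.
Qed.

Lemma bump_supp_beyond : bump_supp `<=` row_cball (`|x0| + delta).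
Proof.
move=> x; rewrite /bump_supp /row_cball /= => h.
by rewrite -(subrK x0 x) (le_trans (ler_normD _ _))// addrC lerD2l.
Qed.

End bump.

Lemma Rintegral_row_gt0 (R : realType) n b (F : 'rV[R]_n -> R) x0 :
  continuous (F : _ -> R^o) -> vanishes_beyond b F -> (forall x, 0 <= F x) -> 0 < F x0 ->
  0 < \int[lebesgue_row n]_x F x.
Proof.
move=> cF vF F0 Fx0; pose e := F x0 / 2.
have e0 : 0 < e by rewrite divr_gt0.
have /nbhs_ballP[r /= r0 hr] : nbhs x0 (F @^-1` [set y | e < y]).
  apply: (cF x0); apply: open_nbhs_nbhs; split; first exact: open_gt.
  by rewrite /= /e ltr_pdivrMr// ltr_pMr// ltr1n.
pose B : set (row_space R n) := [set y : 'rV[R]_n | `|y - x0| < r].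
have mB : measurable B := measurable_row_ball x0 r.
have iF := integrable_row cF vF.
have mF := continuous_measurable_rowT cF.
rewrite /Rintegral fine_gt0//; apply/andP; split; last exact: integrable_lty.
apply: (@lt_le_trans _ _ (\int[lebesgue_row n]_(x in B) (cst e%:E x))%E).
  rewrite integral_cst// [X in (_ * X)%E](_ : _ = ((r *+ 2) ^+ n)%:E); last exact: lebesgue_row_ball.
  rewrite -EFinM lte_fin mulr_gt0// exprn_gt0//.
  by rewrite mulrn_wgt0.
apply: (@le_trans _ _ (\int[lebesgue_row n]_(x in B) (F x)%:E)%E).
  apply: ge0_le_integral => //.
  - by move=> x _; rewrite lee_fin ltW.
  - by apply/measurable_EFinP; exact: measurable_funTS.
  - move=> x /= xr; rewrite lee_fin; apply/ltW/hr.
    by rewrite -ball_normE /= distrC.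
apply: ge0_subset_integral => //; first exact/measurable_EFinP.
by move=> x _; rewrite lee_fin.
Qed.

(** * High-frequency asymptotics of the fractional form *)

(** For waves w = cos and w' = - sin, this is the sum of the squared residuals of
    the two packets, each residual being a combination of both waves. *)
Lemma packet_square_rule (R : comPzRingType) (al be w w' : R) : w ^+ 2 + w' ^+ 2 = 1 ->
  (al * w - be * w') ^+ 2 + (al * w' - be * - w) ^+ 2 = al ^+ 2 + be ^+ 2.
Proof.
move=> h; transitivity ((al ^+ 2 + be ^+ 2) * (w ^+ 2 + w' ^+ 2)); first by ring.
by rewrite h mulr1.
Qed.

(** The term in t^2 (p - p0) is separated from the lower order amplitude [B] by
    (x - y)^2 <= 2 x^2 + 2 y^2; then t >= 1 absorbs the constant term. *)
Lemma energy_bound (R : realFieldType) (t p p0 om c B A : R) : 1 <= t -> `|p - p0| <= om ->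
  ((t ^+ 2 * p - t ^+ 2 * p0) * c - B) ^+ 2 + (t * A) ^+ 2 <=
  2 * t ^+ 4 * om ^+ 2 * c ^+ 2 + t ^+ 2 * (2 * B ^+ 2 + A ^+ 2).
Proof.
move=> t1 pom.
have om0 : 0 <= om by apply: le_trans pom.
have h1 : (p - p0) ^+ 2 <= om ^+ 2 by rewrite -(real_normK (num_real (p - p0))) lerXn2r ?nnegrE.
have h2 : 1 <= t ^+ 2 by rewrite expr_ge1// (le_trans _ t1).
have h3 : B ^+ 2 <= t ^+ 2 * B ^+ 2 by rewrite ler_peMl// sqr_ge0.
have h4 : t ^+ 4 * c ^+ 2 * (p - p0) ^+ 2 <= t ^+ 4 * c ^+ 2 * om ^+ 2.
  by rewrite ler_wpM2l// mulr_ge0 ?sqr_ge0// exprn_even_ge0.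
have h5 := sqr_ge0 ((t ^+ 2 * p - t ^+ 2 * p0) * c + B).
have e1 : ((t ^+ 2 * p - t ^+ 2 * p0) * c + B) ^+ 2 + ((t ^+ 2 * p - t ^+ 2 * p0) * c - B) ^+ 2 =
  2 * (t ^+ 4 * c ^+ 2 * (p - p0) ^+ 2) + 2 * B ^+ 2 by ring.
have e2 : 2 * t ^+ 4 * om ^+ 2 * c ^+ 2 + t ^+ 2 * (2 * B ^+ 2 + A ^+ 2) =
  2 * (t ^+ 4 * c ^+ 2 * om ^+ 2) + 2 * (t ^+ 2 * B ^+ 2) + (t * A) ^+ 2 by ring.
rewrite e2; move: e1 h3 h4 h5.
move: (((t ^+ 2 * p - t ^+ 2 * p0) * c + B) ^+ 2) (((t ^+ 2 * p - t ^+ 2 * p0) * c - B) ^+ 2) => X Y.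
move: (t ^+ 4 * c ^+ 2 * (p - p0) ^+ 2) (t ^+ 2 * B ^+ 2) (B ^+ 2) (t ^+ 4 * c ^+ 2 * om ^+ 2) ((t * A) ^+ 2).
by move=> a1 a2 a3 a4 a5; lra.
Qed.

Lemma residual_packet_rule (R : fieldType) (q d p c w w' t tr L : R) : q != 0 ->
  - (q^-1 * ((d - t ^+ 2 * (q * p * c)) * w + t * tr * w')) - L * (c * w) =
  ((t ^+ 2 * p - L) * c - q^-1 * d) * w - t * (q^-1 * tr) * w'.
Proof. by move=> q0; field. Qed.

Lemma packet_mass_rule (R : comPzRingType) (c w w' : R) : w ^+ 2 + w' ^+ 2 = 1 ->
  c * w * (c * w) + c * w' * (c * w') = c ^+ 2.
Proof. by move=> h; rewrite -[RHS]mulr1 -h; ring. Qed.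

Lemma weighted_energy_rule (R : realFieldType) (q r0 r1 t om c B A : R) : 0 <= q ->
  r0 ^+ 2 + r1 ^+ 2 <= 2 * t ^+ 4 * om ^+ 2 * c ^+ 2 + t ^+ 2 * (2 * B ^+ 2 + A ^+ 2) ->
  q * (r0 * r0) + q * (r1 * r1) <=
  2 * t ^+ 4 * om ^+ 2 * (q * (c * c)) + t ^+ 2 * (2 * (q * (B * B)) + 1 * (q * (A * A))).
Proof.
move=> q0 h; rewrite -mulrDr -!expr2; apply: le_trans (ler_wpM2l q0 h) _.
by rewrite le_eqVlt; apply/orP; left; apply/eqP; ring.
Qed.

Section packet_energy.
Context {R : realType} {n : nat} (M : closedRiemannian R n).
Local Notation leb := (@lebesgue_row R n).
Variable c : chart R n M.
Hypothesis Ac : atlas M c.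
Let W : set 'rV[R]_n := cran c.
Let oW : open W := cran_open Ac.
Let CP i j : Ck 1 W (coef c i j : _ -> R^o) := Ck_S (Ck_coef Ac i j).
Variable xi : 'rV[R]_n.

Definition cometric (x : 'rV[R]_n) : R := (xi *m invmx (metric c x) *m xi^T) ord0 ord0.

Lemma symbolE x : symbol xi (coef c) x = sqrt_det c x * cometric x.
Proof.
rewrite /symbol /ray /cometric mxE mulr_sumr.
under [RHS]eq_bigr do rewrite mxE mulr_suml mulr_sumr.
rewrite exchange_big; apply: eq_bigr => i _; rewrite mulr_sumr; apply: eq_bigr => j _.
by rewrite mxE /coef; ring.
Qed.

Lemma Ck_cometric : Ck 2 W (cometric : _ -> R^o).
Proof.
rewrite (_ : cometric = (fun x => \sum_j (\sum_i xi ord0 i * invmx (metric c x) i j) * xi ord0 j)); last first.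
  apply/funext => x; rewrite /cometric mxE; apply: eq_bigr => j _; rewrite !mxE; congr (_ * _).
apply: Ck_sum => // j _.
have h : Ck 2 W (fun x => \sum_i xi ord0 i * invmx (metric c x) i j : R^o).
  by apply: Ck_sum => // i _; exact: (CkM oW (Ck_cst 2 W (xi ord0 i : R^o)) (Ck_invmetric Ac i j)).
exact: (CkM oW h (Ck_cst 2 W (xi ord0 j : R^o))).
Qed.

Lemma cometric_gt0 x : W x -> xi != 0 -> 0 < cometric x.
Proof.
move=> Wx; apply: posdef_inv; last exact: metric_posdef.
exact: (Defs.metric_sym (metricP M) Ac).
Qed.

Variables (K : set 'rV[R]_n) (b : R).
Hypotheses (cK : closed K) (KW : K `<=` W) (Kb : K `<=` row_cball b).
Variable mu : {measure set (borel M) -> \bar R}.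
Hypothesis hmu : is_volume mu.
Variable chi : 'rV[R]_n -> R.
Hypotheses (Cchi : Ck 2 W (chi : _ -> R^o)) (chi0 : null_off K chi).

Let cq : {in W, continuous (sqrt_det c : _ -> R^o)} := Ck_continuous (Ck_sqrt_det Ac).
Let cchi : {in W, continuous (chi : _ -> R^o)} := Ck_continuous Cchi.

Let B x := (sqrt_det c x)^-1 * divflux (coef c) chi x.
Let A x := (sqrt_det c x)^-1 * transport_term xi (coef c) chi x.

Lemma residual_packet t L a x : W x ->
  residual c L (packet xi t chi a) x =
  ((t ^+ 2 * cometric x - L) * chi x - B x) * wave xi t a x - t * A x * wave xi t (a + pi / 2) x.
Proof.
move=> Wx; rewrite /residual (@divflux_packet _ _ xi t W (coef c) oW CP chi a x Cchi Wx) symbolE /packet /B /A.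
exact: residual_packet_rule (lt0r_neq0 (sqrt_det_gt0 Ac Wx)).
Qed.

Definition packet_fun t a : M -> R := chart_lift c (packet xi t chi a).
Definition packet_residual t L a : M -> R := chart_lift c (residual c L (packet xi t chi a)).

Lemma packet_continuous t a : {in W, continuous (packet xi t chi a : _ -> R^o)}.
Proof. exact: (Ck_continuous (Ck_packet xi t oW a Cchi)). Qed.

Lemma packet_residual_continuous t L a : {in W, continuous (residual c L (packet xi t chi a) : _ -> R^o)}.
Proof. by apply: (residual_continuous Ac); exact: (Ck_packet xi t oW a Cchi). Qed.

(** The sum over the two phases of the squared norms of the packets. *)
Definition mass : R := \int[leb]_(x in W) (sqrt_det c x * chi x ^+ 2).

Lemma packet_integrable2 (F : 'rV[R]_n -> R) :
  {in W, continuous (F : _ -> R^o)} -> null_off K F ->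
  leb.-integrable W (EFin \o (fun x => sqrt_det c x * (F x * F x))).
Proof.
move=> cF F0; apply: (null_off_integrable oW cK KW Kb).
  by do 2 apply: in_continuousM => //.
by apply: null_off_Ml; exact: null_off_Ml.
Qed.

Lemma packet_mass t :
  inner mu (packet_fun t 0) (packet_fun t 0) +
  inner mu (packet_fun t (pi / 2)) (packet_fun t (pi / 2)) = mass.
Proof.
have cp := @packet_continuous t.
rewrite /packet_fun !(inner_chart_lift2 Ac hmu)// -RintegralD//; last 3 first.
- exact: measurable_cran.
- by apply: packet_integrable2 => //; exact: null_off_packet.
- by apply: packet_integrable2 => //; exact: null_off_packet.
apply: eq_Rintegral => x _; rewrite /packet -mulrDr; congr (_ * _).
exact: packet_mass_rule (wave_sqr xi t x).
Qed.

(** Away from the variation [om] of the symbol on the support of [chi], the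
    residual is of order [t] only, whereas the frequency is of order t^2. *)
Lemma packet_energy : exists2 C, 0 <= C &
  forall t p0 om, 1 <= t -> (forall x, K x -> `|cometric x - p0| <= om) ->
  inner mu (packet_residual t (t ^+ 2 * p0) 0) (packet_residual t (t ^+ 2 * p0) 0) +
  inner mu (packet_residual t (t ^+ 2 * p0) (pi / 2)) (packet_residual t (t ^+ 2 * p0) (pi / 2))
  <= 2 * t ^+ 4 * om ^+ 2 * mass + t ^+ 2 * C.
Proof.
have cB : {in W, continuous (B : _ -> R^o)}.
  apply: in_continuousM; first exact: inv_sqrt_det_continuous.
  exact: (divflux_continuous oW CP Cchi).
have cA : {in W, continuous (A : _ -> R^o)}.
  apply: in_continuousM; first exact: inv_sqrt_det_continuous.
  exact: (@transport_continuous _ _ xi W (coef c) oW CP chi Cchi).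
have B0 : null_off K B by apply: null_off_Ml; exact: null_off_divflux.
have A0 : null_off K A by apply: null_off_Ml; exact: null_off_transport.
have mW : measurable (W : set (row_space R n)) := measurable_cran Ac.
have iB := packet_integrable2 cB B0.
have iA := packet_integrable2 cA A0.
have ichi := packet_integrable2 cchi chi0.
exists (\int[leb]_(x in W) (2 * (sqrt_det c x * (B x * B x)) + 1 * (sqrt_det c x * (A x * A x)))).
  apply: Rintegral_ge0 => x Wx; have h y : 0 <= sqrt_det c x * (y * y).
    by rewrite mulr_ge0 ?sqrt_det_ge0// -expr2 sqr_ge0.
  by rewrite mul1r addr_ge0// mulr_ge0.
move=> t p0 om t1 hom.
rewrite /packet_residual !(inner_chart_lift2 Ac hmu); try exact: packet_residual_continuous.
have rho0 a : null_off K (residual c (t ^+ 2 * p0) (packet xi t chi a)).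
  by apply: null_off_residual => //; exact: null_off_packet.
have irho a := packet_integrable2 (@packet_residual_continuous t (t ^+ 2 * p0) a) (rho0 a).
have iBA : leb.-integrable W (EFin \o (fun x => 2 * (sqrt_det c x * (B x * B x)) + 1 * (sqrt_det c x * (A x * A x)))).
  exact: (integrableD mW (integrableZl mW 2 iB) (integrableZl mW 1 iA)).
rewrite -RintegralD//.
have -> : mass = \int[leb]_(x in W) (sqrt_det c x * (chi x * chi x)).
  by apply: eq_Rintegral => x _; rewrite expr2.
rewrite -(Rintegral_comb _ _ mW ichi iBA).
apply: le_Rintegral => //.
- exact: (integrableD mW (irho 0) (irho (pi / 2))).
- exact: (integrableD mW (integrableZl mW _ ichi) (integrableZl mW _ iBA)).
move=> x Wx.
have q0 := sqrt_det_ge0 c x.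
have [Kx|Kx] := pselect (K x); last first.
  by rewrite !rho0// chi0// B0// A0// !(mulr0, addr0).
have wN : wave xi t (pi / 2 + pi / 2) x = - wave xi t 0 x.
  by have := wave_pi xi t 0 x; rewrite add0r.
rewrite !residual_packet// add0r wN.
have h := energy_bound (chi x) (B x) (A x) t1 (hom x Kx).
rewrite -(packet_square_rule _ _ (wave_sqr xi t x)) in h.
exact: weighted_energy_rule q0 h.
Qed.

Variables (lam : nat -> R) (phi : nat -> M -> R).
Hypothesis hspec : spectral_resolution mu lam phi.

(** Meant for [w0] and [w1] the fractional Laplacians of the packets of phases 0
    and pi/2: the sum of their values under the quadratic form of (-Delta)^s. *)
Definition frac_form (w0 w1 : M -> R) t : R :=
  inner mu (packet_fun t 0) w0 + inner mu (packet_fun t (pi / 2)) w1.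

Lemma packet_fun_L2 t a : L2 mu (packet_fun t a).
Proof.
apply: (L2_chart_lift Ac cK KW Kb hmu); first exact: packet_continuous.
exact: null_off_packet.
Qed.

Lemma packet_quasimode s t L eta a w : 0 < s < 1 -> 0 < L -> 0 < eta ->
  is_frac_laplacian mu lam phi s (packet_fun t a) w ->
  `|inner mu (packet_fun t a) w - L `^ s * inner mu (packet_fun t a) (packet_fun t a)| <=
  L `^ s * (inner mu (packet_residual t L a) (packet_residual t L a) / (2 * eta * L ^+ 2)
            + eta / 2 * inner mu (packet_fun t a) (packet_fun t a)).
Proof.
move=> s01 L0 eta0 fw; apply: (quasimode hspec) => //.
- exact: packet_fun_L2.
- apply: (L2_chart_lift Ac cK KW Kb hmu); first exact: packet_residual_continuous.
  by apply: null_off_residual => //; exact: null_off_packet.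
- move=> k; apply: (residual_inner Ac cK KW Kb hmu).
  + exact: (Ck_packet xi t oW a Cchi).
  + exact: null_off_packet.
  + exact: (eigenfunctionP hspec k).
Qed.

(** Of the tolerated error [eta], [quasimode] itself takes one half and the
    variation [eta * p0 / 2] of the symbol one quarter; the remaining energy, of
    order t^2, is negligible before L^2, of order t^4. *)
Lemma packet_asymptotics s p0 eta : 0 < s < 1 -> 0 < p0 -> 0 < eta -> 0 < mass ->
  (forall x, K x -> `|cometric x - p0| <= eta * p0 / 2) ->
  \forall t \near +oo, forall w0 w1,
    is_frac_laplacian mu lam phi s (packet_fun t 0) w0 ->
    is_frac_laplacian mu lam phi s (packet_fun t (pi / 2)) w1 ->
    `|frac_form w0 w1 t - (t ^+ 2 * p0) `^ s * mass| <= eta * ((t ^+ 2 * p0) `^ s * mass).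
Proof.
move=> s01 p00 eta0 m0 hp; have [C C0 hC] := packet_energy.
near=> t => w0 w1 f0 f1.
have t1 : 1 <= t by near: t; exact: nbhs_pinfty_ge.
have tC : 2 * C / (eta ^+ 2 * p0 ^+ 2 * mass) <= t by near: t; apply: nbhs_pinfty_ge; exact: num_real.
set L := t ^+ 2 * p0; have t0 : 0 < t by rewrite (lt_le_trans _ t1).
have L0 : 0 < L by rewrite mulr_gt0// exprn_gt0.
have q0 := packet_quasimode s01 L0 eta0 f0.
have q1 := packet_quasimode s01 L0 eta0 f1.
have e := hC t p0 _ t1 hp.
have m := packet_mass t.
move: q0 q1 e m; rewrite -/L /frac_form.
set a0 := inner _ _ w0; set a1 := inner _ _ w1.
set r0 := inner _ (packet_residual _ _ 0) _; set r1 := inner _ (packet_residual _ _ (pi / 2)) _.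
set u0 := inner _ _ (packet_fun _ 0); set u1 := inner _ _ (packet_fun _ (pi / 2)).
move=> q0 q1 e m.
have -> : a0 + a1 - L `^ s * mass = (a0 - L `^ s * u0) + (a1 - L `^ s * u1) by rewrite -m; ring.
apply: (le_trans (ler_normD _ _)); apply: (le_trans (lerD q0 q1)).
rewrite [leRHS]mulrCA -mulrDr ler_wpM2l ?powR_ge0//.
have -> : r0 / (2 * eta * L ^+ 2) + eta / 2 * u0 + (r1 / (2 * eta * L ^+ 2) + eta / 2 * u1) =
  (r0 + r1) / (2 * eta * L ^+ 2) + eta / 2 * mass by rewrite -m; ring.
have D0 : 0 < 2 * eta * L ^+ 2 by rewrite !mulr_gt0// exprn_gt0.
suff : (r0 + r1) / (2 * eta * L ^+ 2) <= eta / 2 * mass by lra.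
rewrite ler_pdivrMr//; apply: (le_trans e).
set D := eta ^+ 2 * p0 ^+ 2 * mass in tC.
have D1 : 0 < D by rewrite !mulr_gt0// exprn_gt0.
rewrite ler_pdivrMr// in tC.
have tD : 2 * C <= t ^+ 2 * D.
  by apply: (le_trans tC); rewrite ler_wpM2r ?(ltW D1)// expr2 ler_peMl// ltW.
have ttD := ler_wpM2l (sqr_ge0 t) tD.
have -> : 2 * t ^+ 4 * (eta * p0 / 2) ^+ 2 * mass = t ^+ 2 * (t ^+ 2 * D) / 2.
  by rewrite /D; field.
have -> : eta / 2 * mass * (2 * eta * L ^+ 2) = t ^+ 2 * (t ^+ 2 * D).
  by rewrite /D /L; field.
move: ttD; move: (t ^+ 2 * (t ^+ 2 * D)) => X; rewrite mulrCA => ttD; lra.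
Unshelve. all: by end_near. Qed.

End packet_energy.

Section symbol_asymptotics.
Context {R : realType} {n : nat} (M : closedRiemannian R n).
Local Notation leb := (@lebesgue_row R n).
Variable c : chart R n M.
Hypothesis Ac : atlas M c.
Variable mu : {measure set (borel M) -> \bar R}.
Hypothesis hmu : is_volume mu.
Variables (lam : nat -> R) (phi : nat -> M -> R).
Hypothesis hspec : spectral_resolution mu lam phi.
Variables (xi x0 : 'rV[R]_n).
Hypotheses (xi0 : xi != 0) (cx0 : cran c x0).

Definition bump_mass delta : R := \int[leb]_x bump x0 delta x ^+ 2.

Lemma bump_mass_gt0 delta : 0 < delta -> 0 < bump_mass delta.
Proof.
move=> d0.
have cb := in_continuous_sqr (Ck_continuous (@Ck_bumpT _ _ x0 delta 0 setT openT)).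
apply: (@Rintegral_row_gt0 _ _ (`|x0| + delta) _ x0).
- by move=> x; apply: cb; rewrite inE.
- move=> x h; rewrite (bump_null (ltW d0)) ?expr0n// => /bump_supp_beyond.
  by rewrite /row_cball /= leNgt h.
- by move=> x; exact: sqr_ge0.
- by rewrite exprn_gt0// bump_gt0.
Qed.

Lemma near_continuous_close (W : set 'rV[R]_n) (f : 'rV[R]_n -> R) e : open W -> W x0 ->
  {in W, continuous (f : _ -> R^o)} -> 0 < e ->
  \forall delta \near 0^'+, forall x, bump_supp x0 delta x -> `|f x - f x0| <= e.
Proof.
move=> oW Wx cf e0.
have /nbhs_ballP[r /= r0 hr] : nbhs x0 [set x | `|f x0 - f x| <= e].
  have /cvgrPdist_le/(_ _ e0) : (f : _ -> R^o) @ x0 --> (f x0 : R^o) by apply: cf; rewrite inE.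
  by [].
near=> delta => x h; rewrite distrC; apply: hr.
rewrite -ball_normE /= distrC; apply: le_lt_trans h _.
by near: delta; exact: nbhs_right_lt.
Unshelve. all: by end_near. Qed.

Lemma near_bump_supp (W : set 'rV[R]_n) : open W -> W x0 ->
  \forall delta \near 0^'+, bump_supp x0 delta `<=` W.
Proof.
move=> oW Wx.
have /nbhs_ballP[r /= r0 hr] : nbhs x0 W by exact: open_nbhs_nbhs.
near=> delta => x h; apply: hr.
rewrite -ball_normE /= distrC; apply: le_lt_trans h _.
by near: delta; exact: nbhs_right_lt.
Unshelve. all: by end_near. Qed.

(** When [delta] tends to 0, the symbol and the volume density become constant on
    the support of the bump, up to a factor close to 1. *)
Theorem symbol_asymptotics s eta : 0 < s < 1 -> 0 < eta <= 1 ->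
  \forall delta \near 0^'+, \forall t \near +oo, forall w0 w1,
    is_frac_laplacian mu lam phi s (packet_fun c xi (bump x0 delta) t 0) w0 ->
    is_frac_laplacian mu lam phi s (packet_fun c xi (bump x0 delta) t (pi / 2)) w1 ->
    `|frac_form c xi mu (bump x0 delta) w0 w1 t -
      (t ^+ 2 * cometric c xi x0) `^ s * (sqrt_det c x0 * bump_mass delta)| <=
    3 * eta * ((t ^+ 2 * cometric c xi x0) `^ s * (sqrt_det c x0 * bump_mass delta)).
Proof.
move=> s01 /andP[eta0 eta1].
have oW := cran_open Ac.
have p00 := cometric_gt0 Ac cx0 xi0.
have q00 := sqrt_det_gt0 Ac cx0.
have cp := Ck_continuous (Ck_cometric Ac xi).
have cq := Ck_continuous (Ck_sqrt_det Ac).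
near=> delta.
have d0 : 0 < delta by near: delta; exact: nbhs_right_gt.
have KW : bump_supp x0 delta `<=` cran c by near: delta; exact: near_bump_supp.
have hp : forall x, bump_supp x0 delta x -> `|cometric c xi x - cometric c xi x0| <= eta * cometric c xi x0 / 2.
  by near: delta; apply: near_continuous_close cp _ => //; rewrite divr_gt0// mulr_gt0.
have hq : forall x, bump_supp x0 delta x -> `|sqrt_det c x - sqrt_det c x0| <= eta / 2 * sqrt_det c x0.
  by near: delta; apply: near_continuous_close cq _ => //; rewrite mulr_gt0// divr_gt0.
have Cb : Ck 2 (cran c) (bump x0 delta : _ -> R^o) by exact: Ck_bumpT.
have b0 := bump_null (x0 := x0) (ltW d0).
have cb := Ck_continuous Cb.
have mW := measurable_cran Ac.
have cK := @bump_supp_closed _ _ x0 delta.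
have Kb := @bump_supp_beyond _ _ x0 delta.
have bb0 : null_off (bump_supp x0 delta) (fun x => bump x0 delta x ^+ 2) by move=> x /b0 /= ->; rewrite expr0n.
have cbb := in_continuous_sqr cb.
have ib : leb.-integrable (cran c) (EFin \o (fun x => bump x0 delta x ^+ 2)).
  exact: (null_off_integrable oW cK KW Kb cbb bb0).
have ibq : leb.-integrable (cran c) (EFin \o (fun x => sqrt_det c x * bump x0 delta x ^+ 2)).
  apply: (null_off_integrable oW cK KW Kb); first exact: in_continuousM.
  exact: null_off_Ml.
have massE : bump_mass delta = \int[leb]_(x in cran c) bump x0 delta x ^+ 2.
  by rewrite /Rintegral (null_off_integral KW).
have I0 := bump_mass_gt0 d0.
set I := bump_mass delta in massE I0 *.
set N := mass c (bump x0 delta).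
have hN : `|N - sqrt_det c x0 * I| <= eta / 2 * (sqrt_det c x0 * I).
  have iq0 := integrableZl mW (sqrt_det c x0) ib.
  have id := integrableB mW ibq iq0.
  rewrite massE -!(RintegralZl _ mW ib) /N /mass -(RintegralB mW ibq iq0).
  apply: le_trans (le_normr_Rintegral mW id) _.
  rewrite -RintegralZl//; apply: le_Rintegral => //.
  - exact: (integrable_norm id).
  - exact: (integrableZl mW (eta / 2) iq0).
  - move=> x Wx; have [Kx|Kx] := pselect (bump_supp x0 delta x); last first.
      by rewrite b0// expr0n /= !mulr0 subrr normr0.
    rewrite -mulrBl normrM mulrA [X in _ * X]ger0_norm ?sqr_ge0//.
    by rewrite ler_wpM2r ?sqr_ge0// hq.
set X := sqrt_det c x0 * I in hN *.
have X0 : 0 < X by rewrite mulr_gt0.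
have N0 : 0 < N.
  move: hN; rewrite ler_norml => /andP[h _]; apply: lt_le_trans (_ : (1 - eta / 2) * X <= _).
    by rewrite mulr_gt0//; lra.
  by rewrite mulrBl mul1r; lra.
have A := packet_asymptotics Ac cK KW Kb hmu Cb b0 hspec s01 p00 eta0 N0 hp.
apply: filterS A => t A w0 w1 f0 f1; move: (A w0 w1 f0 f1).
set T := (_ `^ s); set F := frac_form _ _ _ _ _ _ _ => h.
have T0 : 0 <= T by exact: powR_ge0.
have -> : F - T * X = (F - T * N) + T * (N - X) by ring.
apply: (le_trans (ler_normD _ _)); apply: (le_trans (lerD h (lexx _))).
rewrite normrM (ger0_norm T0).
have h1 : T * `|N - X| <= T * (eta / 2 * X) by rewrite ler_wpM2l.
have h2 : N <= 2 * X.
  move: hN; rewrite ler_norml => /andP[_ hN].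
  have : eta / 2 * X <= X by rewrite ler_piMl ?ltW//; lra.
  lra.
have h3 : eta * (T * N) <= eta * (T * (2 * X)) by apply: ler_wpM2l; [exact: ltW|exact: ler_wpM2l].
have h4 : 0 <= T * X * eta by rewrite !mulr_ge0// ltW.
have -> : 3 * eta * (T * X) = 3 * (T * X * eta) by ring.
apply: (le_trans (lerD h3 h1)).
have -> : eta * (T * (2 * X)) + T * (eta / 2 * X) = (5 / 2) * (T * X * eta) by field.
lra.
Unshelve. all: by end_near. Qed.

End symbol_asymptotics.

(** * Wave packets on the identified open sets *)

Section packet_test_function.
Context {R : realType} {n : nat} (M : closedRiemannian R n).
Variables (O : set M) (c : chart R n M) (xi x0 : 'rV[R]_n) (delta t a : R).
Hypotheses (Oc : charts_in O c) (d0 : 0 <= delta).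
Hypothesis KW : bump_supp x0 delta `<=` cran c.

Let Ac : atlas M c. Proof. by case: Oc. Qed.
Let u : M -> R := packet_fun c xi (bump x0 delta) t a.
Let KM : set M := cinv c @` bump_supp x0 delta.

Lemma compact_bump_supp : compact (bump_supp x0 delta).
Proof.
apply: bounded_closed_compact; last exact: bump_supp_closed.
exists (`|x0| + delta); split; first exact: num_real.
by move=> r hr x /bump_supp_beyond /le_trans; apply; exact: ltW.
Qed.

Let compact_KM : compact KM.
Proof.
apply: continuous_compact; last exact: compact_bump_supp.
apply: continuous_in_subspaceT => x /[!inE] /KW cx.
by apply: (cinv_continuous Ac); rewrite inE.
Qed.

Let closed_KM : closed KM.
Proof. by apply: compact_closed compact_KM; exact: carrier_hausdorff. Qed.

Let u_out p : ~ KM p -> u p = 0.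
Proof.
move=> Kp; rewrite /u /packet_fun /chart_lift; case: ifPn => // /[!inE] cp.
apply: null_off_packet (bump_null d0) _ _ => Kx; apply: Kp.
by exists (cmap c p) => //; rewrite (cmapK Ac).
Qed.

(** Smoothness in another chart is a matter of composing with the transition
    map near the support, and is trivial away from it. *)
Lemma packet_test_function : test_function O u.
Proof.
split; last first.
  exists KM; split => //.
  by move=> _ [x Kx <-]; case: Oc => _; apply; apply: (cdom_cinv Ac); exact: KW.
move=> k c' Ac'.
have o1 : open (overlap c' c).
  rewrite (_ : overlap c' c = cran c' `&` cinv c' @^-1` cdom c).
    by apply: (open_cinv Ac'); exact: (cdom_open Ac).
  apply/seteqP; split => [_ [p [cp' cp] <-]|x [cx' cx]].
    by split; [exact: (cran_cmap cp')|rewrite /preimage /= (cmapK Ac')].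
  exists (cinv c' x); last exact: (cinvK Ac').
  by split => //; exact: (cdom_cinv Ac').
have o2 : open (cran c' `&` cinv c' @^-1` (~` KM)).
  by apply: (open_cinv Ac'); exact: closed_openC.
have C1 : Ck k (overlap c' c) (u \o cinv c' : _ -> R^o).
  have [sT _] := atlas_compatible (atlasP M) Ac' Ac.
  have CT := sT k.
  apply: (Ck_eq o1 _ (CkM o1 (Ck_bump x0 delta o1 CT) (Ck_wave xi t a o1 CT))).
  move=> x /[!inE] -[p [cp' cp] <-] /=.
  by rewrite /u /packet_fun /chart_lift /transition /= (cmapK Ac' cp') ifT ?inE.
have C2 : Ck k (cran c' `&` cinv c' @^-1` (~` KM)) (u \o cinv c' : _ -> R^o).
  apply: (Ck_eq o2 _ (Ck_cst k _ (0 : R^o))).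
  by move=> x /[!inE] -[_ Kx] /=; rewrite u_out.
apply: Ck_sub (Ck_setU C1 C2) => x cx'.
have [cx|cx] := pselect (cdom c (cinv c' x)).
  left; exists (cinv c' x); last exact: (cinvK Ac').
  by split => //; exact: (cdom_cinv Ac').
right; split => // -[y Ky yx]; apply: cx; rewrite -yx.
by apply: (cdom_cinv Ac); exact: KW.
Qed.

End packet_test_function.

Section same_coordinates.
Context {R : realType} {n : nat}.

Lemma jacobian_id_on (W : set 'rV[R]_n) (f : 'rV[R]_n -> 'rV[R]_n) x :
  open W -> W x -> {in W, f =1 id} -> jacobian f x = 1%:M.
Proof.
move=> oW Wx fE.
have fx : f x = x by apply: fE; rewrite inE.
have D : 'd f x = [the {linear 'rV[R]_n -> 'rV[R]_n} of idfun] :> (_ -> _).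
  apply: diff_unique; first by move=> y; exact: cvg_id.
  apply/eqaddoP => e e0; near=> h.
  have fh : f (h + x) = h + x.
    apply: fE; rewrite inE; near: h.
    have h1 : (fun h : 'rV[R]_n => h + x) @ (0 : 'rV[R]_n) --> x.
      by have := @continuous_row_shift _ _ x 0; rewrite /continuous_at add0r.
    by apply: h1; apply: open_nbhs_nbhs.
  have -> : (f \o shift x - (cst (f x) + [the {linear 'rV[R]_n -> 'rV[R]_n} of idfun])) h = f (h + x) - (f x + h) by [].
  by rewrite fh fx [h + x]addrC subrr normr0 mulr_ge0// ltW.
by apply/row_matrixP => i; rewrite !rowE mulmx1 /jacobian mul_rV_lin1 D.
Unshelve. all: by end_near. Qed.

(** Two charts which agree except for the irrelevant values of [cmap] and [cinv]
    have the same metric, since their transition map is the identity. *)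
Lemma metric_same_chart (M : closedRiemannian R n) (c d : chart R n M) x :
  atlas M c -> atlas M d -> cdom c = cdom d ->
  (forall y, cran c y -> cmap d (cinv c y) = y) -> cran c x ->
  metric c x = metric d x.
Proof.
move=> Ac Ad cd id_cd cx.
have ov : overlap c d x.
  exists (cinv c x); last exact: (cinvK Ac).
  by rewrite -cd setIid; exact: (cdom_cinv Ac).
rewrite (metric_change (metricP M) Ac Ad ov).
have T1 : {in cran c, transition c d =1 id} by move=> y /[!inE] cy; exact: id_cd.
rewrite (jacobian_id_on (cran_open Ac) cx T1) mul1mx trmx1 mulmx1.
by rewrite T1// inE.
Qed.

End same_coordinates.

Section identification.
Context {R : realType} {n : nat} (M1 M2 : closedRiemannian R n).
Variables (O1 : set M1) (O2 : set M2) (psi : M1 -> M2) (psi' : M2 -> M1).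
Hypothesis hO : identification O1 O2 psi psi'.
Variable c : chart R n M1.
Hypothesis Oc : charts_in O1 c.
Let c2 : chart R n M2 := push_chart psi psi' c.
(* The domain and the coordinates of [c3] are those of [c], but [cmap] and [cinv]
   may differ at irrelevant points. *)
Let c3 : chart R n M1 := push_chart psi' psi c2.

Let psiK p : cdom c p -> psi' (psi p) = p.
Proof. by move=> cp; have [_ sO] := Oc; have [_] := ident_fun hO (sO _ cp). Qed.

Lemma cran_push : cran c2 = cran c.
Proof.
apply/seteqP; split => [_ [_ [p cp <-] <-]|_ [p cp <-]].
  by exists p => //=; rewrite psiK.
by exists (psi p); [exists p|rewrite /= psiK].
Qed.

Lemma cran_push2 : cran c3 = cran c.
Proof.
apply/seteqP; split => [_ [_ [_ [p cp <-] <-] <-]|_ [p cp <-]].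
  by exists p => //=; rewrite !psiK.
by exists (psi' (psi p)); [exists (psi p) => //; exists p|rewrite /= !psiK].
Qed.

Lemma cdom_push2 : cdom c3 = cdom c.
Proof.
apply/seteqP; split => [_ [_ [p cp <-] <-]|p cp]; first by rewrite psiK.
by exists (psi p); [exists p|exact: psiK].
Qed.

Lemma cinv_push2 x : cran c x -> cinv c3 x = cinv c x.
Proof. by move=> cx; rewrite /= psiK//; apply: (cdom_cinv Oc.1). Qed.

Lemma charts_in_push : charts_in O2 c2.
Proof. exact: (ident_charts hO). Qed.

Lemma charts_in_push2 : charts_in O1 c3.
Proof. exact: (ident_charts_inv hO charts_in_push). Qed.

Lemma metric_push2 x : cran c x -> metric c3 x = metric c x.
Proof.
move=> cx; apply/esym; apply: metric_same_chart => //.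
- exact: Oc.1.
- exact: charts_in_push2.1.
- exact/esym/cdom_push2.
move=> y cy; have cdy := cdom_cinv Oc.1 cy.
by rewrite /= !psiK// (cinvK Oc.1).
Qed.

Lemma push_chart_lift U : push_fun O2 psi' (chart_lift c U) = chart_lift c2 U.
Proof.
apply/funext => q; rewrite /push_fun /chart_lift /=.
have [cq|cq] := pselect ((psi @` cdom c) q).
  have [p cp pq] := cq.
  rewrite [in RHS]mem_set//; have Oq : O2 q by rewrite -pq; have [_ sO] := Oc; have [] := ident_fun hO (sO _ cp).
  by rewrite mem_set// ifT// inE -pq psiK.
rewrite [in RHS]memNset//; case: ifPn => // /[!inE] Oq.
rewrite memNset// => cq'; apply: cq; exists (psi' q) => //.
by have [_] := ident_inv hO Oq.
Qed.

Variables (mu1 : {measure set (borel M1) -> \bar R}) (mu2 : {measure set (borel M2) -> \bar R}).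
Hypotheses (hmu1 : is_volume mu1) (hmu2 : is_volume mu2).

(** In a chart of O, the inner product of a function with (-Delta)^s u is the
    integral of that function against the density f^u dx, which the two
    manifolds share. *)
Lemma source_pairing lam1 phi1 lam2 phi2 s (u1 : M1 -> R) (u2 : M2 -> R) U f :
  solution_to_source mu1 lam1 phi1 s O1 u1 f ->
  solution_to_source mu2 lam2 phi2 s O2 u2 (fun d => f (push_chart psi' psi d)) ->
  {in cran c, continuous (U : _ -> R^o)} ->
  exists w1 w2, [/\ is_frac_laplacian mu1 lam1 phi1 s u1 w1,
    is_frac_laplacian mu2 lam2 phi2 s u2 w2 &
    inner mu1 (chart_lift c U) w1 = inner mu2 (chart_lift c2 U) w2].
Proof.
move=> [w1 fw1 h1] [w2 fw2 h2] cU; exists w1, w2; split => //.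
have A1 := Oc.1; have A2 := charts_in_push.1.
have mw1 : measurable_fun setT (w1 : borel M1 -> measurableTypeR R) by exact: L2_measurable fw1.1.
have mw2 : measurable_fun setT (w2 : borel M2 -> measurableTypeR R) by exact: L2_measurable fw2.1.
have cq1 := Ck_continuous (Ck_sqrt_det A1).
have cq2 := Ck_continuous (Ck_sqrt_det A2).
rewrite (inner_chart_lift A1 hmu1 cq1 cU mw1).
rewrite (inner_chart_lift A2 hmu2 cq2 _ mw2); last by rewrite cran_push.
rewrite cran_push; congr fine; apply: ae_eq_integral.
- exact: (measurable_cran A1).
- apply/measurable_EFinP; apply: measurable_funM.
    exact: (continuous_measurable_row (cran_open A1) cq1).
  apply: measurable_funM; first exact: (continuous_measurable_row (cran_open A1) cU).
  exact: (measurableT_comp mw1 (measurable_cinv A1)).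
- rewrite -cran_push; apply/measurable_EFinP; apply: measurable_funM.
    exact: (continuous_measurable_row (cran_open A2) cq2).
  apply: measurable_funM; first by rewrite cran_push; exact: (continuous_measurable_row (cran_open A1) cU).
  exact: (measurableT_comp mw2 (measurable_cinv A2)).
- have e1 := h1 _ charts_in_push2; have e2 := h2 _ charts_in_push.
  apply: filterS2 e1 e2 => x + + cx; rewrite -/c2 -/c3 cran_push cran_push2.
  move=> /(_ cx) + /(_ cx) => -> e.
  congr EFin; rewrite mulrCA [RHS]mulrCA -e /sqrt_det metric_push2// cinv_push2//.
Qed.

End identification.

(** * From the symbol to the metric *)

Section symbol_determines_metric.
Context {R : realType}.

(** Polarisation. *)
Lemma quadratic_form_eq0 n (S : 'M[R]_n) : S^T = S ->
  (forall v : 'rV[R]_n, (v *m S *m v^T) ord0 ord0 = 0) -> S = 0.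
Proof.
move=> sS q0; pose e i : 'rV[R]_n := delta_mx ord0 i.
have qE i j : (e i *m S *m (e j)^T) ord0 ord0 = S i j.
  by rewrite trmx_delta -rowE -colE !mxE.
apply/matrixP => i j; rewrite [RHS]mxE.
have := q0 (e i + e j); rewrite mulmxDl linearD/= mulmxDr !mulmxDl.
have -> (A B C D : 'M[R]_1) : (A + B + (C + D)) ord0 ord0 =
  A ord0 ord0 + B ord0 ord0 + (C ord0 ord0 + D ord0 ord0) by rewrite !mxE.
rewrite q0 q0 add0r addr0 !qE.
have -> : S j i = S i j by rewrite -[in LHS]sS mxE.
lra.
Qed.

(** The equality makes the two inverse matrices proportional, so B = k A with
    k^s = sqrt (det B / det A) = k^(n/2); as s < 1 <= n/2, this forces k = 1. *)
Lemma symbol_inj n (s : R) (A B : 'M[R]_n) : (2 <= n)%N -> 0 < s < 1 ->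
  A^T = A -> B^T = B -> posdef A -> posdef B ->
  (forall xi : 'rV[R]_n, xi != 0 ->
    ((xi *m invmx A *m xi^T) ord0 ord0) `^ s * Num.sqrt (\det A) =
    ((xi *m invmx B *m xi^T) ord0 ord0) `^ s * Num.sqrt (\det B)) ->
  A = B.
Proof.
move=> n2 /andP[s0 s1] sA sB pA pB h.
have dA := posdef_det pA; have dB := posdef_det pB.
have uA := posdef_unit pA; have uB := posdef_unit pB.
set a := Num.sqrt (\det A) in h; set b := Num.sqrt (\det B) in h.
have a0 : 0 < a by rewrite sqrtr_gt0.
have b0 : 0 < b by rewrite sqrtr_gt0.
pose k := (b / a) `^ s^-1.
have k0 : 0 < k by rewrite powR_gt0// divr_gt0.
have ks : k `^ s = b / a by rewrite -powRrM mulVf ?gt_eqF// powRr1// divr_ge0 ?ltW.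
(* Taking s-th roots makes the dual quadratic forms proportional. *)
have formE (xi : 'rV[R]_n) : xi != 0 ->
    (xi *m invmx A *m xi^T) ord0 ord0 = k * (xi *m invmx B *m xi^T) ord0 ord0.
  move=> xi0; have := h xi xi0.
  have := posdef_inv sA pA xi0; have := posdef_inv sB pB xi0.
  set p := (_ *m _) _ _; set q := (_ *m _) _ _ => p0 q0 e.
  have e1 : q `^ s = (k * p) `^ s.
    rewrite powRM ?ltW// ks; apply: (mulIf (lt0r_neq0 a0)).
    by rewrite e mulrAC divfK ?gt_eqF// mulrC.
  have inv z : 0 < z -> (z `^ s) `^ s^-1 = z.
    by move=> z0; rewrite -powRrM mulfV ?gt_eqF// powRr1// ltW.
  by rewrite -[LHS]inv// e1 inv// mulr_gt0.
have invE : invmx A = k *: invmx B.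
  apply/eqP; rewrite -subr_eq0; apply/eqP; apply: quadratic_form_eq0.
    by rewrite linearB linearZ/= !trmx_inv sA sB.
  move=> v; have [->|v0] := eqVneq v 0; first by rewrite !mul0mx mxE.
  rewrite mulmxBr mulmxBl -scalemxAr -scalemxAl.
  have -> (C D : 'M[R]_1) : (C - k *: D) ord0 ord0 = C ord0 ord0 - k * D ord0 ord0 by rewrite !mxE.
  by rewrite formE// subrr.
have BE : B = k *: A.
  by rewrite -[LHS]mul1mx -(mulmxV uA) invE -scalemxAr -scalemxAl -mulmxA mulVmx// mulmx1.
have detE : \det B = k ^+ n * \det A by rewrite BE detZ.
(* The square of the equality k^s = b / a. *)
have kE : k `^ (s * 2) = k `^ n%:R.
  rewrite powRrM ks !powR_mulrn ?ltW ?divr_gt0//.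
  rewrite expr_div_n !sqr_sqrtr ?ltW//.
  by rewrite detE mulfK ?gt_eqF.
have /eqP : (s * 2) * ln k = n%:R * ln k by rewrite -!ln_powR kE.
rewrite -subr_eq0 -mulrBl mulf_eq0 => /orP[|/eqP lnk].
  have n2R : (2 : R) <= n%:R by rewrite ler_nat.
  by move=> /eqP e; exfalso; lra.
have k1 : k = 1 by rewrite -[k]lnK ?posrE// lnk expR0.
by rewrite BE k1 scale1r.
Qed.

Lemma eq_of_close (x y : R) : 0 < x + y ->
  (forall eta, 0 < eta <= 1 -> `|x - y| <= 3 * eta * (x + y)) -> x = y.
Proof.
move=> xy h; apply/eqP; rewrite -subr_eq0 -normr_le0.
set d := `|x - y| in h *; have d0 : 0 <= d := normr_ge0 _.
rewrite leNgt; apply/negP => dp.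
(* This value of [eta] would bound [d] by d / 2. *)
have [H|H] := leP (d / (6 * (x + y))) 1.
  have := h (d / (6 * (x + y))); rewrite divr_gt0// ?mulr_gt0// => /(_ H).
  have -> : 3 * (d / (6 * (x + y))) * (x + y) = d / 2 by field; rewrite gt_eqF.
  lra.
have := h 1; rewrite ltr01 lexx => /(_ isT); move: H.
by rewrite ltr_pdivlMr ?mulr_gt0//; lra.
Qed.

End symbol_determines_metric.

Lemma scaled_symbols_close (R : realType) (F T m e y z y' z' : R) : 0 < T -> 0 < m ->
  `|F - T * y * (z * m)| <= e * (T * y * (z * m)) ->
  `|F - T * y' * (z' * m)| <= e * (T * y' * (z' * m)) ->
  `|y * z - y' * z'| <= e * (y * z + y' * z').
Proof.
move=> T0 m0.
have mulE u v : T * u * (v * m) = T * m * (u * v) by ring.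
rewrite !mulE; move: (y * z) (y' * z') => X X' h h'.
have Tm0 : 0 < T * m by rewrite mulr_gt0.
rewrite -(ler_pM2l Tm0) -[X in X * `|_|](gtr0_norm Tm0) -normrM.
have -> : T * m * (X - X') = (F - T * m * X') - (F - T * m * X) by ring.
apply: le_trans (ler_normB _ _) _; apply: le_trans (lerD h' h) _.
by rewrite -mulrDr -mulrDr [X' + X]addrC mulrCA.
Qed.

Section identified_symbols.
Context {R : realType} {n : nat} (M1 M2 : closedRiemannian R n).
Variables (s : R) (mu1 : {measure set (borel M1) -> \bar R}) (mu2 : {measure set (borel M2) -> \bar R}).
Hypotheses (hs : 0 < s < 1) (hmu1 : is_volume mu1) (hmu2 : is_volume mu2).
Variables (lam1 : nat -> R) (phi1 : nat -> M1 -> R) (lam2 : nat -> R) (phi2 : nat -> M2 -> R).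
Hypotheses (hspec1 : spectral_resolution mu1 lam1 phi1) (hspec2 : spectral_resolution mu2 lam2 phi2).
Variables (O1 : set M1) (O2 : set M2) (psi : M1 -> M2) (psi' : M2 -> M1).
Hypothesis hO : identification O1 O2 psi psi'.
Hypothesis hL : forall u : M1 -> R, test_function O1 u ->
  exists f : chart R n M1 -> 'rV[R]_n -> R,
    solution_to_source mu1 lam1 phi1 s O1 u f /\
    solution_to_source mu2 lam2 phi2 s O2 (push_fun O2 psi' u)
      (fun c => f (push_chart psi' psi c)).
Variable c : chart R n M1.
Hypothesis Oc : charts_in O1 c.
Let c2 : chart R n M2 := push_chart psi psi' c.

Lemma packet_pairing xi x0 delta t a : 0 <= delta -> bump_supp x0 delta `<=` cran c ->
  exists w1 w2, [/\
    is_frac_laplacian mu1 lam1 phi1 s (packet_fun c xi (bump x0 delta) t a) w1,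
    is_frac_laplacian mu2 lam2 phi2 s (packet_fun c2 xi (bump x0 delta) t a) w2 &
    inner mu1 (packet_fun c xi (bump x0 delta) t a) w1 =
    inner mu2 (packet_fun c2 xi (bump x0 delta) t a) w2].
Proof.
move=> d0 KW.
have [f [f1 f2]] := hL (packet_test_function xi t a Oc d0 KW).
rewrite /packet_fun (push_chart_lift hO Oc) in f2.
apply: (source_pairing hO Oc hmu1 hmu2 f1 f2).
apply: (packet_continuous Oc.1).
by apply: Ck_bumpT; exact: (cran_open Oc.1).
Qed.

(** The two sides are the leading coefficients of one and the same quantity, the
    pairing of a wave packet with its image by the common operator. *)
Lemma same_symbol xi x : xi != 0 -> cran c x ->
  cometric c xi x `^ s * sqrt_det c x = cometric c2 xi x `^ s * sqrt_det c2 x.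
Proof.
move=> xi0 cx.
have A1 := Oc.1; have A2 := (charts_in_push hO Oc).1.
have c2x : cran c2 x by rewrite (cran_push hO Oc).
have p1 := cometric_gt0 A1 cx xi0; have q1 := sqrt_det_gt0 A1 cx.
have p2 := cometric_gt0 A2 c2x xi0; have q2 := sqrt_det_gt0 A2 c2x.
set X1 := LHS; set X2 := RHS.
have X10 : 0 < X1 by rewrite mulr_gt0 ?powR_gt0.
have X20 : 0 < X2 by rewrite mulr_gt0 ?powR_gt0.
apply: eq_of_close; first exact: addr_gt0.
move=> eta eta0.
have S1 := symbol_asymptotics A1 hmu1 hspec1 xi0 cx hs eta0.
have S2 := symbol_asymptotics A2 hmu2 hspec2 xi0 c2x hs eta0.
have [delta [[T1 T2] [d0 KW]]] := @filter_ex _ (0^'+ : set_system R) _ _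
  (filterI (filterI S1 S2) (filterI (nbhs_right_gt 0) (near_bump_supp (cran_open A1) cx))).
have [t [[H1 H2] t0]] := @filter_ex _ (+oo : set_system R) _ _
  (filterI (filterI T1 T2) (nbhs_pinfty_gt (num_real (0 : R)))).
have [u1 [u2 [fu1 fu2 eu]]] := packet_pairing xi t 0 (ltW d0) KW.
have [v1 [v2 [fv1 fv2 ev]]] := packet_pairing xi t (pi / 2) (ltW d0) KW.
have := H2 _ _ fu2 fv2; have := H1 _ _ fu1 fv1.
rewrite /frac_form -eu -ev; set F := inner _ _ _ + inner _ _ _.
rewrite !powRM ?sqr_ge0 ?(ltW p1) ?(ltW p2) ?(ltW t0)//.
set T := t `^ s * t `^ s; set m := bump_mass _ _.
have T0 : 0 < T by rewrite mulr_gt0 ?powR_gt0.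
have m0 : 0 < m by exact: bump_mass_gt0.
exact: scaled_symbols_close.
Qed.

End identified_symbols.

Theorem corollary1p2 (R : realType) (n : nat) (hn : (2 <= n)%N)
  (s : R) (hs : 0 < s < 1)
  (M1 M2 : closedRiemannian R n)
  (mu1 : {measure set (borel M1) -> \bar R})
  (mu2 : {measure set (borel M2) -> \bar R})
  (hmu1 : is_volume mu1) (hmu2 : is_volume mu2)
  (lam1 : nat -> R) (phi1 : nat -> M1 -> R)
  (lam2 : nat -> R) (phi2 : nat -> M2 -> R)
  (hspec1 : spectral_resolution mu1 lam1 phi1)
  (hspec2 : spectral_resolution mu2 lam2 phi2)
  (O1 : set M1) (O2 : set M2)
  (hO1 : open O1) (hO2 : open O2) (hO1ne : O1 !=set0) (hO2ne : O2 !=set0)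
  (psi : M1 -> M2) (psi' : M2 -> M1)
  (hO : identification O1 O2 psi psi')
  (hL : forall u : M1 -> R, test_function O1 u ->
    exists f : chart R n M1 -> 'rV[R]_n -> R,
      solution_to_source mu1 lam1 phi1 s O1 u f /\
      solution_to_source mu2 lam2 phi2 s O2 (push_fun O2 psi' u)
        (fun c => f (push_chart psi' psi c))) :
  forall c, charts_in O1 c -> forall x, cran c x ->
    metric c x = metric (push_chart psi psi' c) x.
Proof.
move=> c Oc x cx.
have A1 := Oc.1; have A2 := (charts_in_push hO Oc).1.
have c2x : cran (push_chart psi psi' c) x by rewrite (cran_push hO Oc).
apply: (symbol_inj hn hs).
- exact: (Defs.metric_sym (metricP M1) A1).
- exact: (Defs.metric_sym (metricP M2) A2).
- exact: metric_posdef.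
- exact: metric_posdef.
- move=> xi xi0; exact: (same_symbol hs hmu1 hmu2 hspec1 hspec2 hO hL Oc xi0 cx).
Qed.
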